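(* For every $w\in W^{\Lambda_0}$, $$\mathcal{T}_w=\bigsqcup_{\substack{\nu\ \text{a partition}\\ \ell(\nu)\le d(w)}}SST_{\mathbf{B}^\vee_{<0}}(\nu^\pi)_{\phi(w)}\times SST_{\mathbf{B}_{>0}}(\nu^\pi)_{\psi(w)}.$$
   Context: **Weights.** $\mathbb{Z}^\times=\mathbb{Z}\setminus\{0\}$; $\mathfrak{h}=\bigoplus_{i\in\mathbb{Z}^\times}\mathbb{C}E_{ii}$ is the Cartan subalgebra of $\mathfrak{gl}_\infty$ (complex $\mathbb{Z}^\times\times\mathbb{Z}^\times$ matrices of finite support), $\langle\epsilon_i,E_{jj}\rangle=\delta_{ij}$; $h_0=E_{-1,-1}-E_{11}$, $h_i=E_{ii}-E_{i+1,i+1}$, $h_{-i}=E_{-i-1,-i-1}-E_{-i,-i}$ and $\alpha_0=\epsilon_{-1}-\epsilon_1$, $\alpha_i=\epsilon_i-\epsilon_{i+1}$, $\alpha_{-i}=\epsilon_{-i-1}-\epsilon_{-i}$ ($i\ge1$). $\Lambda_0\in\mathfrak{h}^*$: $\langle\Lambda_0,E_{-i,-i}\rangle=-\langle\Lambda_0,E_{ii}\rangle=\frac12$ ($i\ge1$). **Words.** On the letters $\mathbf{B}_{>0}=\{1<2<3<\cdots\}$ let $\widetilde f_i(i)=i+1$, $\widetilde e_i(i+1)=i$ ($i>0$), all other values being the formal symbol $\mathbf 0$; on the letters $\mathbf{B}^\vee_{<0}=\{-1^\vee<-2^\vee<\cdots\}$ let $\widetilde f_{-i}(-i^\vee)=-(i+1)^\vee$,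 $\widetilde e_{-i}(-(i+1)^\vee)=-i^\vee$ ($i>0$), all other values being $\mathbf 0$. For a letter or word $b$, $\varepsilon_i(b)=\max\{k:\widetilde e_i^kb\ne\mathbf 0\}$, $\varphi_i(b)=\max\{k:\widetilde f_i^kb\neq\mathbf 0\}$. Words $w_1\cdots w_r$ are tensors $w_1\otimes\cdots\otimes w_r$, with the rule: $\widetilde f_i(b_1\otimes b_2)=\widetilde f_ib_1\otimes b_2$ if $\varphi_i(b_1)>\varepsilon_i(b_2)$ and $b_1\otimes\widetilde f_ib_2$ otherwise; $\widetilde e_i(b_1\otimes b_2)=\widetilde e_ib_1\otimes b_2$ if $\varphi_i(b_1)\ge\varepsilon_i(b_2)$ and $b_1\otimes\widetilde e_ib_2$ otherwise ($\mathbf 0\otimes b=b\otimes\mathbf 0=\mathbf 0$; the empty word is sent to $\mathbf 0$). **Tableaux.** $\nu^\pi$ is the $180^\circ$-rotation of the Young diagram of a partition $\nu$ (rows right-justified, $i$-th row from the bottom of length $\nu_i$, columns bottom-aligned). $SST_{\mathcal A}(\nu^\pi)$ is the set of semistandard tableaux of shape $\nu^\pi$ with entries in $\mathcal A$ (rows weakly increasing left to right, columns strictly increasing top to bottom). The operators act on $SST_{\mathbf{B}_{>0}}(\nu^\pi)$ ($i>0$) and $SST_{\mathbf{B}^\vee_{<0}}(\nu^\pi)$ ($i<0$) via the reading word (rows top to bottom, each row right to left). **$\mathcal{T}$ and its operators.** $\mathcal{T}=\bigsqcup_\nu SST_{\mathbf{B}^\vee_{<0}}(\nu^\pi)\times SST_{\mathbf{B}_{>0}}(\nu^\pi)$.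 On $(S,T)\in\mathcal{T}$, operators with $i<0$ act on $S$, those with $i>0$ on $T$. For $i=0$: number columns from right to left $k=1,2,\dots$ (columns beyond the shape are empty), let $s_k,t_k$ be the smallest entries of the $k$-th columns of $S,T$, and $\sigma_k=+$ if the $k$-th column is empty or ($s_k>-1^\vee$ and $t_k>1$), $\sigma_k=-$ if ($s_k=-1^\vee$ and $t_k=1$), $\sigma_k=\cdot$ otherwise. In $(\ldots,\sigma_2,\sigma_1)$ repeatedly replace pairs $(\sigma_{s'},\sigma_s)=(-,+)$, $s'>s$, with only dots in between by $(\cdot,\cdot)$, until no $-$ is left of a $+$. $\widetilde e_0(S,T)$ removes $-1^\vee$ and $1$ from the columns of $S$ and $T$ at the leftmost remaining $-$ ($\mathbf 0$ if none); $\widetilde f_0(S,T)$ adds $-1^\vee$ and $1$ on top of the columns of $S$ and $T$ at the rightmost remaining $+$. **Weyl group.** $W$ is generated by $s_i(\lambda)=\lambda-\langle\lambda,h_i\rangle\alpha_i$ ($i\in\mathbb{Z}$) on $\mathfrak{h}^*$; $s_i$ acts on $\mathbb{Z}^\times$ as the transposition $(i\;i{+}1)$ for $i>0$, $(i{-}1\;i)$ for $i<0$, $(-1\;1)$ for $i=0$; $\ell$ is the length. $W^{\Lambda_0}=\{w\in W\mid\ell(ws_i)>\ell(w)\text{ for all }i\ne0\}$. For $w\in W^{\Lambda_0}$, $\lambda(w)$ is the partition with $\lambda(w)_i=|\{j\in\mathbb{Z}^\times\mid -i<w^{-1}(j),\ j<w(-i)\}|$ ($i\ge1$). **$\mathcal{T}_w$.**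 For $w\in W^{\Lambda_0}$ with reduced expression $w=s_{i_1}\cdots s_{i_r}$, $\mathcal{T}_w=\{\widetilde f_{i_1}^{m_1}\cdots\widetilde f_{i_r}^{m_r}(\emptyset,\emptyset)\mid m_1,\dots,m_r\ge0\}\setminus\{\mathbf 0\}$ (independent of the reduced expression). **Flags.** Let $d=d(w)$ be the diagonal length of $\lambda=\lambda(w)$ and write in Frobenius notation $\lambda(w)=(\alpha_1,\dots,\alpha_d\mid\beta_1,\dots,\beta_d)$, where $\alpha_i=\lambda'_i-i+1$, $\beta_i=\lambda_i-i+1$ (diagonal box counted in both). Put $\phi(w)=(\alpha_d,\dots,\alpha_1)$ and $\psi(w)=(\beta_d,\dots,\beta_1)$. For a flag $\phi=(\phi_1\le\cdots\le\phi_d)$ of positive integers and $\ell(\nu)\le d$ ($\ell(\nu)$ = number of nonzero parts), $SST_{\mathbf{B}^\vee_{<0}}(\nu^\pi)_\phi$ (resp. $SST_{\mathbf{B}_{>0}}(\nu^\pi)_\phi$) is the set of tableaux in $SST_{\mathbf{B}^\vee_{<0}}(\nu^\pi)$ (resp. $SST_{\mathbf{B}_{>0}}(\nu^\pi)$) whose entries in the $i$-th row from the bottom are $\le-\phi_{d-i+1}^\vee$ (resp. $\le\phi_{d-i+1}$) for $1\le i\le d$; thus for $\phi(w)$ and $\psi(w)$ the bounds on the $i$-th row from the bottom are $-\alpha_i^\vee$ and $\beta_i$ respectively. *)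

(* Defs.v *)
From HB Require Import structures.
From mathcomp Require Import all_boot all_order all_algebra finmap.
From mathcomp Require Import complex.
From mathcomp Require Import boolp classical_sets functions cardinality reals.

Set Implicit Arguments.
Unset Strict Implicit.
Unset Printing Implicit Defensive.

Import Order.TTheory GRing.Theory Num.Theory.
Local Open Scope classical_set_scope.
Local Open Scope ring_scope.

(** * The Weyl group *)

Definition Zx := {j : int | j != 0}.

(* [zpos n] is n + 1 and [zneg n] is - (n + 1). *)
Definition zpos (n : nat) : Zx := Sub (Posz n.+1) isT.
Definition zneg (n : nat) : Zx := Sub (Negz n) isT.

(* The two elements of Zx exchanged by s_i, so that h_i = E_ll - E_rr and
   alpha_i = eps_l - eps_r with l = zleft i and r = zright i. *)
Definition zleft (i : int) : Zx :=
  match i with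
  | Posz 0 => zneg 0
  | Posz n.+1 => zpos n
  | Negz n => zneg n.+1
  end.

Definition zright (i : int) : Zx :=
  match i with
  | Posz 0 => zpos 0
  | Posz n.+1 => zpos n.+1
  | Negz n => zneg n
  end.

Definition ztransp (i : int) (j : Zx) : Zx :=
  if j == zleft i then zright i else if j == zright i then zleft i else j.

Definition word_act (u : seq int) : Zx -> Zx :=
  foldr (fun i g => ztransp i \o g) id u.

Lemma word_act_rcons u i j : word_act (rcons u i) j = word_act u (ztransp i j).
Proof. by elim: u => //= k u ->. Qed.

Section WeylGroup.
Variable R : realType.

(* The Cartan subalgebra has basis (E_jj)_j, so a linear form lam on it is
   the family of its values lam j = <lam, E_jj>. *)
Definition hdual := Zx -> R[i].

Definition epsilon (j : Zx) : hdual := fun k => (j == k)%:R.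

Definition pair_coroot (lam : hdual) (i : int) : R[i] :=
  lam (zleft i) - lam (zright i).

Definition simple_root (i : int) : hdual :=
  epsilon (zleft i) - epsilon (zright i).

Definition reflection (i : int) (lam : hdual) : hdual :=
  lam - pair_coroot lam i *: simple_root i.

Definition word_map (u : seq int) : hdual -> hdual :=
  foldr (fun i g => reflection i \o g) id u.

(* The s_i are involutions, so the group they generate consists of the
   products of finite words. *)
Record weyl := Weyl {
  weyl_map :> hdual -> hdual;
  weyl_mapP : exists u, weyl_map = word_map u }.

Lemma weyl_mulr_subproof (w : weyl) (i : int) :
  exists u, w \o reflection i = word_map u.
Proof.
case: (weyl_mapP w) => u ->; exists (rcons u i); rewrite /word_map.
by elim: u => //= j u <-.
Qed.

(* w s_i *)
Definition weyl_mulr (w : weyl) (i : int) : weyl :=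
  Weyl (weyl_mulr_subproof w i).

Lemma weyl_length_subproof (w : weyl) :
  exists n, `[< exists2 u, size u = n & weyl_map w = word_map u >].
Proof.
by case: (weyl_mapP w) => u eq_wu; exists (size u); apply/asboolP; exists u.
Qed.

Definition weyl_length (w : weyl) : nat := ex_minn (weyl_length_subproof w).

Definition reduced_expression (w : weyl) (u : seq int) : Prop :=
  weyl_map w = word_map u /\ size u = weyl_length w.

Definition in_WLambda0 (w : weyl) : Prop :=
  forall i : int, i != 0 -> (weyl_length w < weyl_length (weyl_mulr w i))%N.

(* The action of W on Zx in which s_i acts as [ztransp i], and the inverse
   action; [word_act_unique] shows that the choice of a word is immaterial. *)
Definition weyl_word (w : weyl) : seq int := projT1 (cid (weyl_mapP w)).
Definition weyl_act (w : weyl) : Zx -> Zx := word_act (weyl_word w).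
Definition weyl_actV (w : weyl) : Zx -> Zx := word_act (rev (weyl_word w)).

Lemma zleft_neq_right i : zleft i != zright i.
Proof.
apply/eqP => /(congr1 val); case: i => [[|n]|n] //= [] /eqP.
- by rewrite eqn_leq ltnn andbF.
- by rewrite eqn_leq ltnn.
Qed.

Lemma ztranspK i : involutive (ztransp i).
Proof.
move=> j; have neq := zleft_neq_right i; rewrite /ztransp.
case: (eqVneq j (zleft i)) => [->|jl]; first by rewrite eq_sym (negPf neq) eqxx.
case: (eqVneq j (zright i)) => [->|jr]; first by rewrite eqxx.
by rewrite (negPf jl) (negPf jr).
Qed.

Lemma reflection_epsilon i j : reflection i (epsilon j) = epsilon (ztransp i j).
Proof.
have neq := zleft_neq_right i.
rewrite /reflection /pair_coroot /simple_root /ztransp.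
case: (eqVneq j (zleft i)) => [->|jl].
  rewrite /epsilon eqxx (negPf neq) subr0 scale1r -/(epsilon _) -/(epsilon _).
  by rewrite opprB addrC subrK.
case: (eqVneq j (zright i)) => [->|jr].
  rewrite {2 3}/epsilon eqxx eq_sym (negPf neq) sub0r scaleN1r opprK.
  by rewrite addrC subrK.
by rewrite {2 3}/epsilon (negPf jl) (negPf jr) subrr scale0r subr0.
Qed.

Lemma word_map_epsilon u j : word_map u (epsilon j) = epsilon (word_act u j).
Proof. by elim: u => //= i u ->; rewrite reflection_epsilon. Qed.

Lemma epsilon_inj : injective epsilon.
Proof.
move=> j k /(congr1 (fun lam => lam k)); rewrite /epsilon eqxx.
by case: eqP => // _ /eqP; rewrite eq_sym oner_eq0.
Qed.

Lemma word_act_unique u v : word_map u = word_map v -> word_act u =1 word_act v.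
Proof. by move=> uv j; apply: epsilon_inj; rewrite -!word_map_epsilon uv. Qed.

Lemma weyl_actE (w : weyl) u : weyl_map w = word_map u -> weyl_act w =1 word_act u.
Proof.
by move=> wu; apply: word_act_unique; rewrite -wu -(projT2 (cid (weyl_mapP w))).
Qed.

Lemma weyl_actK (w : weyl) : cancel (weyl_act w) (weyl_actV w).
Proof.
rewrite /weyl_act /weyl_actV => j; elim: (weyl_word w) j => //= i u IH j.
by rewrite rev_cons word_act_rcons ztranspK IH.
Qed.

(** * The partition lambda(w) and its Frobenius notation

   Partitions are indexed from 1 here, as functions; the value at 0 is junk.
   The sets counted below are finite: w fixes all but finitely many elements
   of Zx, and lambda(w) has finitely many nonzero parts. *)

(* [zneg i.-1] is - i for i >= 1. *)
Definition lambda_part (w : weyl) (i : nat) : nat :=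
  #|` fset_set [set j : Zx | val (zneg i.-1) < val (weyl_actV w j) /\
                             val j < val (weyl_act w (zneg i.-1))] |.

Definition conj_part (lam : nat -> nat) (i : nat) : nat :=
  #|` fset_set [set k : nat | (0 < k)%N /\ (i <= lam k)%N] |.

Definition diag_length (lam : nat -> nat) : nat :=
  #|` fset_set [set i : nat | (0 < i)%N /\ (i <= lam i)%N] |.

Definition weyl_diag (w : weyl) : nat := diag_length (lambda_part w).

Definition frob_alpha (w : weyl) (i : nat) : nat :=
  (conj_part (lambda_part w) i - i + 1)%N.

Definition frob_beta (w : weyl) (i : nat) : nat :=
  (lambda_part w i - i + 1)%N.

Definition flag_phi (w : weyl) : seq nat :=
  rev [seq frob_alpha w i | i <- iota 1 (weyl_diag w)].

Definition flag_psi (w : weyl) : seq nat :=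
  rev [seq frob_beta w i | i <- iota 1 (weyl_diag w)].

End WeylGroup.

Local Open Scope nat_scope.

(** * Words

   A letter is a positive natural number n.  It stands for n in B_{>0} and for
   -n^v in B^v_{<0}.  Since -1^v < -2^v < ..., the order of either alphabet is
   that of nat, and since f_{-i} (-i^v) = - (i + 1)^v, the operators with index
   -i on B^v_{<0} become those with index i on B_{>0}.  The formal symbol 0 is
   [None]. *)

Definition e_letter (i x : nat) : option nat :=
  if x == i.+1 then Some i else None.

Definition f_letter (i x : nat) : option nat :=
  if x == i then Some i.+1 else None.

(* The largest k <= n such that the k-th iterate of g at x is defined. *)
Definition max_iter (T : eqType) (g : T -> option T) (n : nat) (x : T) : nat :=
  \max_(k < n.+1 | iter k (obind g) (Some x) != None) k.

(* An iterate f_i^2 of a letter is never defined. *)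
Definition phi_letter (i x : nat) : nat := max_iter (f_letter i) 1 x.

(* [e_word_rec i n] is e_i on words of length n, split as a letter and a word
   of length n - 1.  By [e_word_iter_bound], e_i^k is never defined on a word
   of length less than k, so [max_iter] computes the value of epsilon_i. *)
Fixpoint e_word_rec (i n : nat) (s : seq nat) : option (seq nat) :=
  match n, s with
  | n'.+1, b :: s' =>
      if max_iter (e_word_rec i n') n' s' <= phi_letter i b
      then omap (cons^~ s') (e_letter i b)
      else omap (cons b) (e_word_rec i n' s')
  | _, _ => None
  end.

Definition e_word (i : nat) (s : seq nat) : option (seq nat) :=
  e_word_rec i (size s) s.

Definition eps_word (i : nat) (s : seq nat) : nat :=
  max_iter (e_word i) (size s) s.

Fixpoint f_word (i : nat) (s : seq nat) : option (seq nat) :=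
  match s with
  | [::] => None
  | b :: s' =>
      if eps_word i s' < phi_letter i b
      then omap (cons^~ s') (f_letter i b)
      else omap (cons b) (f_word i s')
  end.

Lemma e_word_recP i n s s' : e_word_rec i n s = Some s' ->
  size s' = size s /\ count_mem i.+1 s = (count_mem i.+1 s').+1.
Proof.
elim: n s s' => [|n IH] [|b s] s' //=; case: ifP => _.
  rewrite /e_letter; case: (eqVneq b i.+1) => //= _ [<-] /=.
  by rewrite (ltn_eqF (ltnSn i)).
case E: (e_word_rec i n s) => [t|] //= [<-] /=.
by have [-> ->] := IH _ _ E; rewrite addnS.
Qed.

Lemma e_word_iter_bound i k s :
  iter k (obind (e_word i)) (Some s) != None -> k <= size s.
Proof.
move=> H; apply: leq_trans (count_size (pred1 i.+1) s).
elim: k s H => // k IH s; rewrite iterSr /=.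
case E: (e_word i s) => [t|]; last by rewrite (_ : iter _ _ _ = None) // iter_fix.
by have [_ ->] := e_word_recP E; apply: IH.
Qed.

Lemma e_word_cons i b s :
  e_word i (b :: s) =
    if eps_word i s <= phi_letter i b then omap (cons^~ s) (e_letter i b)
    else omap (cons b) (e_word i s).
Proof.
suff E : max_iter (e_word_rec i (size s)) (size s) s = eps_word i s.
  by rewrite /e_word /= E.
rewrite /eps_word /max_iter; apply: eq_bigl => k; congr (_ != _).
suff : iter k (obind (e_word_rec i (size s))) (Some s)
         = iter k (obind (e_word i)) (Some s) /\
       (forall t, iter k (obind (e_word i)) (Some s) = Some t ->
          size t = size s) by case.
elim: (k : nat) => [|m [IH1 IH2]] /=; first by split=> // t [<-].
rewrite IH1; case E: (iter m _ _) => [t|] //=; have st := IH2 _ E.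
by rewrite /e_word st; split=> // t' /e_word_recP [-> _].
Qed.

(** * Tableaux

   A tableau of shape nu^pi is the list of its rows from bottom to top, each
   row being listed from right to left.  Hence row r, column k (counted from
   the bottom and from the right, starting at 0) is the entry k of the list r. *)

Definition tableau := seq (seq nat).

Definition is_partition (nu : seq nat) : bool := sorted geq nu && (0 \notin nu).

(* Semistandard tableaux of shape nu^pi, in either alphabet. *)
Definition SST (nu : seq nat) : set tableau :=
  [set t : tableau |
    [/\ map size t = nu,
        all (all (fun x => 0 < x)) t,
        all (sorted geq) t &
        forall r k, r.+1 < size t -> k < size (nth [::] t r.+1) ->
          nth 0 (nth [::] t r.+1) k < nth 0 (nth [::] t r) k]].

(* The bound on row i = r + 1 from the bottom is phi_{d - i + 1}, which is the
   entry d - r - 1 of the list phi of length d. *)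
Definition SST_flag (phi nu : seq nat) : set tableau :=
  SST nu `&`
  [set t : tableau | forall r, r < size phi ->
     all (fun x => x <= nth 0 phi (size phi - r.+1)) (nth [::] t r)].

Definition reading_word (t : tableau) : seq nat := flatten (rev t).

(* The tableau with the shape of t and reading word s. *)
Definition fill_word (t : tableau) (s : seq nat) : tableau :=
  rev (reshape (rev (map size t)) s).

Definition f_tableau (i : nat) (t : tableau) : option tableau :=
  omap (fill_word t) (f_word i (reading_word t)).

(** * The operator f_0 *)

(* Column c + 1 from the right, from bottom to top. *)
Definition column (t : tableau) (c : nat) : seq nat :=
  [seq nth 0 r c | r <- t & c < size r].

Definition smallest (s : seq nat) : nat := foldr minn (head 0 s) s.

Inductive sign := Plus | Minus | Dot.

Definition is_plus (a : sign) : bool := if a is Plus then true else false.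
Definition is_minus (a : sign) : bool := if a is Minus then true else false.
Definition is_dot (a : sign) : bool := if a is Dot then true else false.

Definition column_sign (x : tableau * tableau) (c : nat) : sign :=
  let s := column x.1 c in
  let t := column x.2 c in
  if nilp s || (1 < smallest s) && (1 < smallest t) then Plus
  else if (smallest s == 1) && (smallest t == 1) then Minus
  else Dot.

(* Signs are listed from right to left, i.e. as sigma_1, sigma_2, ..., up to
   the first empty column.  The further ones are all +, to the left of every -,
   hence neither cancelled nor the rightmost + . *)
Definition signature (x : tableau * tableau) : seq sign :=
  [seq column_sign x c | c <- iota 0 (size (head [::] x.1)).+1].

(* (a, b) is a pair of places with sigma_b = -, sigma_a = +, b to the left of
   a and only dots in between. *)
Definition cancellable (sg : seq sign) (p : nat * nat) : bool :=
  [&& p.1 < p.2, is_plus (nth Dot sg p.1), is_minus (nth Dot sg p.2) &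
      all (fun k => is_dot (nth Dot sg k)) (iota p.1.+1 (p.2 - p.1.+1))].

Definition cancel_step (sg : seq sign) : seq sign :=
  let places := iota 0 (size sg) in
  if [seq p <- [seq (a, b) | a <- places, b <- places] | cancellable sg p]
    is p :: _ then set_nth Dot (set_nth Dot sg p.1 Dot) p.2 Dot
  else sg.

(* Each effective step removes two signs, so no cancellable pair is left. *)
Definition reduced_signature (sg : seq sign) : seq sign :=
  iter (size sg) cancel_step sg.

(* Puts the letter 1 on top of column c + 1 from the right. *)
Definition add_on_top (c : nat) (t : tableau) : tableau :=
  let h := size (column t c) in
  set_nth [::] t h (set_nth 0 (nth [::] t h) c 1).

Definition f_zero (x : tableau * tableau) : option (tableau * tableau) :=
  let sg := reduced_signature (signature x) in
  let c := find is_plus sg in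
  if c < size sg then Some (add_on_top c x.1, add_on_top c x.2) else None.

(** * Demazure crystals *)

Definition f_op (i : int) (x : tableau * tableau) :
    option (tableau * tableau) :=
  match i with
  | Posz 0 => f_zero x
  | Posz n.+1 => omap (pair x.1) (f_tableau n.+1 x.2)
  | Negz n => omap (pair^~ x.2) (f_tableau n.+1 x.1)
  end.

(* f_{i_1}^{m_1} ... f_{i_r}^{m_r} (emptyset, emptyset) *)
Definition f_monomial (u : seq int) (m : seq nat) : option (tableau * tableau) :=
  foldr (fun im x => iter im.2 (obind (f_op im.1)) x)
    (Some ([::], [::])) (zip u m).

(* T_w, for a reduced expression u of w. *)
Definition demazure (u : seq int) : set (tableau * tableau) :=
  [set x | exists2 m, size m = size u & f_monomial u m = Some x].

(* Main.v *)
Require Import Defs.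
From mathcomp Require Import all_boot all_order all_algebra finmap complex.
From mathcomp Require Import boolp classical_sets functions cardinality reals.
From mathcomp Require Import zify.

(* Induction on a reduced word i :: u.  If w = s_i w' with both in W^{Lambda_0}
   and l(w) = l(w') + 1, then w' maps some -(p + 1) to the left and some q + 1 to
   the right element exchanged by s_i.  By Frobenius' description of lambda(w),
   beta_r = w(-r) and alpha_r = - w(r) for r <= d, and w(-r) > 0 exactly for
   r <= d.  Hence passing from w' to w raises a single bound from |i| to |i| + 1,
   the bounds of the lower rows being at least |i| + 2 and those of the upper
   rows less than |i|, or, if i = 0, adds a row with both bounds equal to 1.
   The set for w is therefore stable under f_i, and an element of it which is
   not in the set for w' has an entry |i| + 1 in the row whose bound changed (a
   column of full height if i = 0).  That entry is the first letter i or i + 1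
   of the reading word, so it is not cancelled and e_i can be applied; iterating
   e_i leads back to the set for w'. *)

(** No operator [e_i] is ever formed on tableaux. A word is split at its rightmost uncancelled
    letter [i + 1]; lowering that letter gives a word which [f_i] sends back to the given one, and
    exhibiting this preimage is all that the descent needs. The same facts on words serve for
    [i = 0] once signs are read as letters: there the split finds the column that loses its top box.

    The bounds are total functions of the row, with value 0 from the row of index d(w) on. Entries
    being positive, a bound 0 makes a row empty, so the flags and the condition on the length of nu
    become one condition, and [i = 0] also amounts to raising bounds at one index, from 0 to 1 in
    both components.

    The Weyl group enters only through its faithful action on the nonzero integers. Minimal length
    becomes a comparison of words with a prescribed action, and the exchange argument for adjacent
    transpositions gives the position of the two values that [s_i] exchanges. *)

Set Implicit Arguments.
Unset Strict Implicit.
Unset Printing Implicit Defensive.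

Import Order.TTheory GRing.Theory Num.Theory.
Local Open Scope nat_scope.
Local Open Scope classical_set_scope.

(** * Words *)

(* zify does not identify convertible instances of [count]. *)
Ltac count_lia :=
  repeat match goal with H : context [count _ _] |- _ => revert H end;
  repeat match goal with |- context [@count ?T ?p ?s] =>
    let n := fresh "n" in set n := (@count T p s); clearbody n end;
  intros; lia.

(** The tensor rule read from the right: [i.+1] adds an uncancelled letter, and [i] cancels one to
    its right if there is any, whence the truncated predecessor. *)
Fixpoint eps_rec (i : nat) (s : seq nat) : nat :=
  if s is b :: s' then
    if b == i.+1 then (eps_rec i s').+1
    else if b == i then (eps_rec i s').-1 else eps_rec i s'
  else 0.

Lemma phi_letterE i x : phi_letter i x = (x == i).
Proof.
rewrite /phi_letter /max_iter /f_letter.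
rewrite big_mkcond !big_ord_recl big_ord0 /=.
by case: (x == i).
Qed.

Lemma eps_rec_size i s : eps_rec i s <= size s.
Proof. by elim: s => //= b s IH; case: ifP => _; [|case: ifP => _]; lia. Qed.

(** The branch taken by [e_word] depends only on [eps_word] of tails, so the formula for shorter
    words suffices. This breaks the circularity between the two functions; since [e_i] preserves
    length, [eps_wordE] can then iterate the step. *)
Lemma e_word_eps_rec i s :
  (forall t, size t < size s -> eps_word i t = eps_rec i t) ->
  match e_word i s with
  | None => eps_rec i s = 0
  | Some s' => eps_rec i s = (eps_rec i s').+1
  end.
Proof.
elim: s => [|b s IH] // H.
rewrite e_word_cons phi_letterE H //.
have {}IH := IH (fun t lt_ts => H t (ltnW lt_ts)).
rewrite /e_letter /=.
case: (eqVneq b i.+1) => [->|ni1].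
  rewrite (gtn_eqF (ltnSn i)); case: leqP => [|e0] /=.
    rewrite leqn0 => /eqP ->.
    by rewrite eqxx (ltn_eqF (ltnSn i)).
  by move: IH; case: (e_word i s) => [s'|] //= IH; rewrite ?eqxx IH // in e0 *.
case: (eqVneq b i) => [->|ni] /=; case: leqP => /= e0.
- by move: e0; case: (eps_rec i s) => [|[]].
- move: IH; case: (e_word i s) => [s'|] /= IH; last by rewrite IH in e0.
  by rewrite (ltn_eqF (ltnSn i)) eqxx; lia.
- by apply/eqP; rewrite -leqn0.
- move: IH; case: (e_word i s) => [s'|] /= IH; last by rewrite IH in e0.
  by rewrite (negPf ni1) (negPf ni).
Qed.

Lemma eps_wordE i s : eps_word i s = eps_rec i s.
Proof.
have [n] := ubnP (size s); elim: n s => // n IHn s /ltnSE le_sn.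
have step t : size t = size s ->
    match e_word i t with
    | None => eps_rec i t = 0
    | Some t' => eps_rec i t = (eps_rec i t').+1
    end.
  move=> st; apply: e_word_eps_rec => v lt_vt.
  by apply: IHn; rewrite (leq_trans lt_vt) // st.
have iterE k t : size t = size s ->
    (iter k (obind (e_word i)) (Some t) != None) = (k <= eps_rec i t).
  elim: k t => // k IHk t st; rewrite iterSr /=.
  have := step t st; case E: (e_word i t) => [t'|] ->.
    by apply: IHk; have [->] := e_word_recP E.
  by rewrite (_ : iter _ _ _ = None) // iter_fix.
rewrite /eps_word /max_iter; apply/eqP; rewrite eqn_leq; apply/andP; split.
  by apply/bigmax_leqP => k; rewrite iterE.
have lt_e : eps_rec i s < (size s).+1 by rewrite ltnS eps_rec_size.
by apply: (leq_bigmax_cond (Ordinal lt_e)); rewrite iterE.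
Qed.

(* The position of the letter on which f_i acts, or the length of the word if
   there is none. *)
Fixpoint fpos (i : nat) (s : seq nat) : nat :=
  if s is b :: s' then
    if (b == i) && (eps_rec i s' == 0) then 0 else (fpos i s').+1
  else 0.

Lemma f_wordE i s : f_word i s =
  if fpos i s < size s
  then Some (take (fpos i s) s ++ i.+1 :: drop (fpos i s).+1 s) else None.
Proof.
elim: s => //= b s IH; rewrite eps_wordE phi_letterE /f_letter IH.
case: (eqVneq b i) => [->|ni] /=.
  rewrite ltnS leqn0; case: ifP => _ //=; first by rewrite drop0.
  by rewrite ltnS; case: ifP.
by rewrite ltnS; case: ifP.
Qed.

(** Last clause: an [i] just before the letter acted on would have no uncancelled [i.+1] behind it
    either, and [f_i] would act there instead. In a tableau this rules out an equal right
    neighbour. *)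
Lemma fposP i s : fpos i s < size s ->
  [/\ nth 0 s (fpos i s) = i, eps_rec i (drop (fpos i s).+1 s) = 0 &
      forall c, c.+1 = fpos i s -> nth 0 s c != i].
Proof.
elim: s => //= b s IH; case: ifP => /= [/andP[/eqP-> /eqP] es _|nbs].
  by rewrite drop0.
rewrite ltnS => /IH [nth_s eps_s prev]; split => // -[|c] [fc] /=.
  apply: contraFneq nbs => ->; rewrite eqxx /=.
  move: fc eps_s nth_s; case: (s) => //= b' s'; case: ifP => //= _ _.
  rewrite drop0 => -> ->.
  by rewrite (ltn_eqF (ltnSn i)) eqxx.
exact: prev.
Qed.

(** The ballot condition on suffixes: each [i] is cancelled by an [i.+1] to its right within the
    word. *)
Fixpoint ballot (i : nat) (s : seq nat) : bool :=
  if s is b :: s' then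
    (count_mem i s <= count_mem i.+1 s) && ballot i s'
  else true.

Lemma ballot_catr i s1 s2 : ballot i (s1 ++ s2) -> ballot i s2.
Proof. by elim: s1 => //= b s1 IH /andP[_ /IH]. Qed.

Lemma ballot_count i s : ballot i s -> count_mem i s <= count_mem i.+1 s.
Proof. by case: s => // b s /andP[]. Qed.

Lemma eps_rec_ballot i s t : ballot i s ->
  eps_rec i (s ++ t) + count_mem i s = count_mem i.+1 s + eps_rec i t.
Proof.
elim: s => [|b s IH] /=; first by rewrite addn0.
move=> /andP[le_c bs]; have {}IH := IH bs.
case: (eqVneq b i.+1) le_c => [->|ni1]; first by rewrite (gtn_eqF (ltnSn i)) /=; count_lia.
by case: (eqVneq b i) => [_|_] /=; count_lia.
Qed.

(** The displayed letter is the one on which [e_i] acts: all [i.+1] of [s2] are cancelled within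
    [s2], and all [i] of [s1] within [s1]. *)
Lemma eps_rec_split i s : 0 < eps_rec i s ->
  exists s1 s2, [/\ s = s1 ++ i.+1 :: s2, ballot i s1 & eps_rec i s2 = 0].
Proof.
elim: s => //= b s IH.
have [es|es] := posnP (eps_rec i s).
  rewrite es /=; case: (eqVneq b i.+1) => [->|_]; last by case: ifP.
  by exists [::], s.
have [s1 [s2 [def_s bs1 es2]]] := IH es.
move=> eb; exists (b :: s1), s2; split; rewrite ?def_s //= bs1 andbT.
have := eps_rec_ballot (i.+1 :: s2) bs1; rewrite -def_s /= eqxx es2.
have := ballot_count bs1.
move: eb; case: (eqVneq b i.+1) => [->|ni1]; first by rewrite (gtn_eqF (ltnSn i)); count_lia.
by case: (eqVneq b i) => [_|_] /=; count_lia.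
Qed.

Lemma fpos_ballot i s1 s2 : ballot i s1 -> eps_rec i s2 = 0 ->
  fpos i (s1 ++ i :: s2) = size s1.
Proof.
move=> bs1 es2; elim: s1 bs1 => [|b s1 IH] /=; first by rewrite eqxx es2.
move=> /andP[le_c bs1]; rewrite IH //; case: ifP => // /andP[/eqP eb /eqP e0].
have := eps_rec_ballot (i :: s2) bs1; rewrite e0.
by move: le_c; rewrite eb eqxx (ltn_eqF (ltnSn i)); count_lia.
Qed.

Lemma f_word_ballot i s1 s2 : ballot i s1 -> eps_rec i s2 = 0 ->
  f_word i (s1 ++ i :: s2) = Some (s1 ++ i.+1 :: s2).
Proof.
move=> bs1 es2; rewrite f_wordE fpos_ballot // size_cat /= addnS ltnS leq_addr.
by rewrite take_size_cat // drop_cat ltnNge leqnSn /= subSn // subnn /= drop0.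
Qed.

(** An [i.+1] can only be cancelled by an [i] to its left, and a weakly decreasing word has none
    there. *)
Lemma count_sorted_le_eps_rec i s t : sorted geq s ->
  count_mem i.+1 s <= eps_rec i (s ++ t).
Proof.
elim: s => //= b s IH p_s; have {}IH := IH (path_sorted p_s).
case: (eqVneq b i.+1) => [_|_] //; case: (eqVneq b i) => [eb|ni] //=.
rewrite add0n (count_memPn _) //; apply/negP => i1s.
have /allP/(_ _ i1s) := order_path_min (rev_trans leq_trans) p_s.
by rewrite /= eb ltnn.
Qed.

Lemma eps_rec_cat_ge i s t : eps_rec i t <= eps_rec i (s ++ t) + count_mem i s.
Proof.
elim: s => [|b s IH] /=; first by rewrite addn0.
case: (eqVneq b i.+1) => [->|_]; first by rewrite (gtn_eqF (ltnSn i)) /=; count_lia.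
by case: ifP => _ /=; count_lia.
Qed.

Lemma eps_rec_cat0 i s t : i \notin s -> i.+1 \notin s ->
  eps_rec i (s ++ t) = eps_rec i t.
Proof.
elim: s => //= b s IH; rewrite !in_cons !negb_or => /andP[nb ns] /andP[nb1 ns1].
by rewrite eq_sym (negPf nb1) eq_sym (negPf nb) IH.
Qed.

(** The suffix that starts at the first [i] of [s] contains no [i.+1] of [s], so all the [i] of [s]
    need partners in [t]. *)
Lemma ballot_sorted_count i s t : sorted geq s -> i \in s -> ballot i (s ++ t) ->
  count_mem i s <= count_mem i.+1 t.
Proof.
elim: s => //= b s IH p_s; rewrite in_cons => ibs /andP[].
have [eb|nb] := eqVneq b i; last first.
  move: ibs; rewrite eq_sym (negPf nb) /= => ibs _ bst.
  by rewrite add0n IH ?(path_sorted p_s).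
rewrite eb (ltn_eqF (ltnSn i)) !count_cat add0n (_ : count_mem i.+1 s = 0).
  by count_lia.
apply/count_memPn/negP => i1s.
have /allP/(_ _ i1s) := order_path_min (rev_trans leq_trans) p_s.
by rewrite /= eb ltnn.
Qed.

(** * Tableaux *)

Definition len (t : tableau) r := size (nth [::] t r).

Definition ent (t : tableau) r k := nth 0 (nth [::] t r) k.

(* The row lengths are automatically weakly decreasing, since [ent] is 0
   outside of the shape. *)
Record istab (t : tableau) : Prop := IsTab {
  tab_pos : forall r k, k < len t r -> 0 < ent t r k;
  tab_row : forall r k, k.+1 < len t r -> ent t r k.+1 <= ent t r k;
  tab_col : forall r k, k < len t r.+1 -> ent t r.+1 k < ent t r k;
  tab_ne : forall r, r < size t -> 0 < len t r }.

Lemma len_gt_size t r k : k < len t r -> r < size t.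
Proof. by case: (ltnP r (size t)) => // ?; rewrite /len nth_default. Qed.

Lemma ent_gt0 t r k : 0 < ent t r k -> k < len t r.
Proof. by case: (ltnP k (len t r)) => // ?; rewrite /ent nth_default. Qed.

Lemma tab_row_le t r k l : istab t -> k <= l -> l < len t r ->
  ent t r l <= ent t r k.
Proof.
move=> tab_t; elim: l => [|l IH]; first by rewrite leqn0 => /eqP ->.
rewrite leq_eqVlt => /predU1P[-> //|/ltnSE le_kl] lt_l.
by apply: leq_trans (IH le_kl (ltnW lt_l)); apply: tab_row.
Qed.

Lemma tab_len_leS t r : istab t -> len t r.+1 <= len t r.
Proof.
move=> tab_t; case: leqP => // /(tab_col tab_t).
by move/(leq_ltn_trans (leq0n _))/ent_gt0; rewrite ltnn.
Qed.

Lemma tab_len_le t r s : istab t -> r <= s -> len t s <= len t r.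
Proof.
move=> tab_t; elim: s => [|s IH]; first by rewrite leqn0 => /eqP ->.
rewrite leq_eqVlt => /predU1P[-> //|/ltnSE /IH].
by apply: leq_trans; apply: tab_len_leS.
Qed.

Lemma tab_sorted t r : istab t -> sorted geq (nth [::] t r).
Proof. by move=> tab_t; apply/(sortedP 0) => k; apply: tab_row. Qed.

Lemma tab_size t r : istab t -> (r < size t) = (0 < len t r).
Proof.
by move=> tab_t; apply/idP/idP => [|/len_gt_size //]; apply: tab_ne.
Qed.

Lemma tab_shape s t : istab s -> istab t -> (forall r, len s r = len t r) ->
  map size s = map size t.
Proof.
move=> tab_s tab_t eq_len.
have le_size a b : istab a -> istab b -> (forall r, len a r = len b r) ->
    size a <= size b.
  move=> tab_a tab_b eq_l; rewrite leqNgt; apply/negP => lt_ba.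
  by have := tab_ne tab_a lt_ba; rewrite eq_l -tab_size // ltnn.
have eq_sz : size s = size t by apply/eqP; rewrite eqn_leq !le_size.
apply: (@eq_from_nth _ 0); rewrite !size_map // => r lt_r.
by rewrite !(nth_map [::]) -?eq_sz //; apply: eq_len.
Qed.

Lemma shape_len s t : map size s = map size t -> forall r, len s r = len t r.
Proof.
move=> eq_st r; have eq_sz : size s = size t by rewrite -!(size_map size) eq_st.
case: (ltnP r (size s)) => ?; last by rewrite /len !nth_default -?eq_sz.
by rewrite /len -!(nth_map _ 0) -?eq_sz // eq_st.
Qed.

Lemma tab_ext s t : istab s -> istab t -> (forall r, len s r = len t r) ->
  (forall r k, k < len t r -> ent s r k = ent t r k) -> s = t.
Proof.
move=> tab_s tab_t eq_len eq_ent.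
have eq_sz : size s = size t.
  by rewrite -(size_map size s) (tab_shape tab_s tab_t eq_len) size_map.
apply: (@eq_from_nth _ [::]) => // r lt_r.
apply: (@eq_from_nth _ 0); first exact: eq_len.
by move=> k lt_k; apply: eq_ent; rewrite -eq_len.
Qed.

Lemma SST_istab nu t : 0 \notin nu -> SST nu t <-> map size t = nu /\ istab t.
Proof.
move=> nz; split=> [[sh /allP pos_t /allP row_t col_t]|[sh tab_t]].
  have row_mem r : 0 < len t r -> nth [::] t r \in t.
    by move/len_gt_size; apply: mem_nth.
  split => //; split.
  - move=> r k lt_k.
    have /allP : all (fun x => 0 < x) (nth [::] t r).
      by apply: pos_t; apply: row_mem; apply: leq_ltn_trans lt_k.
    by apply; apply: mem_nth.
  - move=> r k lt_k.
    have /(sortedP 0) : sorted geq (nth [::] t r).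
      by apply: row_t; apply: row_mem; apply: leq_ltn_trans lt_k.
    exact.
  - by move=> r k lt_k; apply: col_t => //; apply: len_gt_size lt_k.
  - move=> r lt_r; rewrite lt0n; apply: contra nz => /eqP len0.
    by rewrite -sh -len0; apply: map_f; apply: mem_nth.
split => //.
- apply/(all_nthP [::]) => r _; apply/(all_nthP 0) => k.
  exact: tab_pos.
- by apply/(all_nthP [::]) => r _; apply: tab_sorted.
- by move=> r k _; apply: tab_col.
Qed.

Lemma tab_partition t : istab t -> is_partition (map size t).
Proof.
move=> tab_t; apply/andP; split.
  apply/(sortedP 0) => r; rewrite size_map => lt_r.
  rewrite !(nth_map [::]) ?(ltnW lt_r) //.
  exact: (tab_len_leS r tab_t).
apply/mapP => -[row /(nthP [::])[r lt_r <-]] len0.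
by have := tab_ne tab_t lt_r; rewrite /len -len0.
Qed.

(** * Changing one entry *)

Section Update.
Variables (A B : tableau) (l1 l2 : seq nat).

Definition upd (x : nat) : tableau := A ++ (l1 ++ x :: l2) :: B.

Lemma len_upd x y r : len (upd x) r = len (upd y) r.
Proof.
rewrite /len !nth_cat; case: ifP => // _.
by case: (r - size A) => //=; rewrite !size_cat.
Qed.

Lemma size_upd x y : size (upd x) = size (upd y).
Proof. by rewrite !size_cat. Qed.

Lemma nth_upd x : nth [::] (upd x) (size A) = l1 ++ x :: l2.
Proof. by rewrite nth_cat ltnn subnn. Qed.

Lemma ent_upd x y r k : ent (upd y) r k =
  if (r == size A) && (k == size l1) then y else ent (upd x) r k.
Proof.
case: (eqVneq r (size A)) => [->|nr] /=.
  rewrite /ent !nth_upd !nth_cat; case: ltngtP => [||->] //.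
    by case E: (k - size l1) => //; lia.
  by rewrite subnn.
rewrite /ent !nth_cat; case: ifP => // ltF.
by case E: (r - size A) => //; lia.
Qed.

Lemma size_lt_len_upd x : size l1 < len (upd x) (size A).
Proof. by rewrite /len nth_upd size_cat /= addnS ltnS leq_addr. Qed.

Lemma ent_upd_here x : ent (upd x) (size A) (size l1) = x.
Proof. by rewrite (ent_upd x x) !eqxx. Qed.

Lemma istab_upd x y : istab (upd x) -> 0 < y ->
  (forall k, k.+1 = size l1 -> y <= ent (upd x) (size A) k) ->
  ((size l1).+1 < len (upd x) (size A) ->
     ent (upd x) (size A) (size l1).+1 <= y) ->
  (forall r, r.+1 = size A -> y < ent (upd x) r (size l1)) ->
  (size l1 < len (upd x) (size A).+1 ->
     ent (upd x) (size A).+1 (size l1) < y) ->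
  istab (upd y).
Proof.
move=> tab_x y0 right left below above.
split=> [r k|r k|r k|r]; rewrite ?(len_upd y x) ?(size_upd y x).
- by rewrite (ent_upd x y); case: ifP => // _; apply: tab_pos.
- rewrite !(ent_upd x y) => lt_k.
  case: (eqVneq r (size A)) => [er|nr] /=; last exact: tab_row.
  case: (eqVneq k.+1 (size l1)) => [ek|nk].
    by rewrite ltn_eqF ?ek // er; apply: right.
  case: (eqVneq k (size l1)) => [ek|nk'].
    by rewrite er ek; apply: left; rewrite -er -ek.
  exact: tab_row.
- rewrite !(ent_upd x y) => lt_k.
  case: (eqVneq k (size l1)) => [ek|nk]; rewrite ?andbT ?andbF; last exact: tab_col.
  case: (eqVneq r.+1 (size A)) => [er|nr].
    by rewrite ltn_eqF ?er // ek; apply: below.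
  case: (eqVneq r (size A)) => [er|nr'].
    by rewrite er ek; apply: above; rewrite -er -ek.
  exact: tab_col.
- exact: tab_ne.
Qed.

Lemma reading_upd x : reading_word (upd x) =
  (flatten (rev B) ++ l1) ++ x :: l2 ++ flatten (rev A).
Proof.
by rewrite /reading_word rev_cat rev_cons cat_rcons flatten_cat /= -!catA.
Qed.

Lemma fill_upd x y :
  fill_word (upd x) ((flatten (rev B) ++ l1) ++ y :: l2 ++ flatten (rev A)) =
  upd y.
Proof.
rewrite -reading_upd /fill_word /reading_word.
rewrite (_ : map size (upd x) = map size (upd y)).
  by rewrite -map_rev flattenK revK.
by rewrite !map_cat /= !size_cat.
Qed.

End Update.

Lemma flatten_split (T : Type) (L : seq (seq T)) s1 x s2 :
  flatten L = s1 ++ x :: s2 -> exists L1 l1 l2 L2,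
    [/\ L = L1 ++ (l1 ++ x :: l2) :: L2, s1 = flatten L1 ++ l1 &
        s2 = l2 ++ flatten L2].
Proof.
elim: L s1 => [|l L IH] s1 /=; first by case: s1.
elim: l s1 => [|y l IHl] s1 /=.
  move/IH => [L1 [l1 [l2 [L2 [-> -> ->]]]]].
  by exists ([::] :: L1), l1, l2, L2.
case: s1 => [|z s1] /= [-> E].
  by exists [::], [::], l, L; split.
have [L1 [l1 [l2 [L2 [eqL -> ->]]]]] := IHl _ E.
case: L1 eqL => [|l' L1] /= [-> ->].
  by exists [::], (z :: l1), l2, L2.
by exists ((z :: l') :: L1), l1, l2, L2.
Qed.

Lemma reading_split t s1 x s2 : reading_word t = s1 ++ x :: s2 ->
  exists A B l1 l2, [/\ t = upd A B l1 l2 x, s1 = flatten (rev B) ++ l1 &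
                        s2 = l2 ++ flatten (rev A)].
Proof.
move=> eq_s; have [L1 [l1 [l2 [L2 [eqt -> ->]]]]] := flatten_split eq_s.
exists (rev L2), (rev L1), l1, l2; split; rewrite ?revK //.
by rewrite -[t]revK eqt rev_cat rev_cons cat_rcons.
Qed.

Lemma count_nth_le (T : Type) (x0 : T) (p q : pred T) s t :
  (forall k, k < size s -> p (nth x0 s k) -> k < size t /\ q (nth x0 t k)) ->
  count p s <= count q t.
Proof.
elim: s t => //= x s IH [|y t] H.
  have -> : p x = false by apply/negP => px; have [] := H 0 isT px.
  by rewrite add0n; apply: (IH [::]) => k lt_s ps; have [] := H k.+1 lt_s ps.
apply: leq_add; last by apply: IH => k lt_s ps; have := H k.+1 lt_s ps.
by have := H 0 isT; case: (p x) => //= /(_ isT) [_ ->].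
Qed.

(** * The operators with nonzero index *)

Lemma f_tableauP i t t' : f_tableau i t = Some t' ->
  exists A B l1 l2, [/\ t = upd A B l1 l2 i, t' = upd A B l1 l2 i.+1,
    eps_rec i (l2 ++ flatten (rev A)) = 0 &
    forall k, k.+1 = size l1 -> ent t (size A) k != i].
Proof.
rewrite /f_tableau f_wordE; case: ifP => // lt_p [<-].
have [nth_p eps_p prev] := fposP lt_p.
have := cat_take_drop (fpos i (reading_word t)) (reading_word t).
rewrite (drop_nth 0 lt_p) nth_p => /esym def_s.
have [A [B [l1 [l2 [def_t def_s1 def_s2]]]]] := reading_split def_s.
exists A, B, l1, l2; split => //; first by rewrite def_s1 def_s2 def_t fill_upd.
  by rewrite -def_s2.
move=> k sz_k; rewrite def_t /ent nth_upd nth_cat -sz_k ltnSn.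
have sz_p : fpos i (reading_word t) = size (flatten (rev B)) + k.+1.
  by rewrite -(size_takel (ltnW lt_p)) def_s1 size_cat sz_k.
have := prev (size (flatten (rev B)) + k); rewrite -addnS sz_p => /(_ erefl).
rewrite def_t reading_upd -catA nth_cat ltnNge leq_addr /= addKn.
by rewrite nth_cat -sz_k ltnSn.
Qed.

Lemma f_tableau_upd i A B l1 l2 : ballot i (flatten (rev B) ++ l1) ->
  eps_rec i (l2 ++ flatten (rev A)) = 0 ->
  f_tableau i (upd A B l1 l2 i) = Some (upd A B l1 l2 i.+1).
Proof.
by move=> bal eps0; rewrite /f_tableau reading_upd f_word_ballot //= fill_upd.
Qed.

(** The critical neighbour is the one below. Were it [i.+1], every [i] of the row from the changed
    entry leftwards would stand on an [i.+1]; these are read after [l2] and outnumber its [i], so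
    one would remain uncancelled, against [eps0]. *)
Lemma f_tableau_istab i t t' : istab t -> f_tableau i t = Some t' -> istab t'.
Proof.
move=> tab_t /f_tableauP [A [B [l1 [l2 [def_t -> eps0 prev]]]]].
have lt_h := size_lt_len_upd A B l1 l2 i; have ent_h := ent_upd_here A B l1 l2 i.
have row_h := nth_upd A B l1 l2 i.
rewrite -def_t in lt_h ent_h row_h; apply: (istab_upd (x := i)); rewrite -?def_t //.
- move=> k sz_k; rewrite ltn_neqAle eq_sym prev // -{1}ent_h -sz_k.
  by apply: tab_row; rewrite ?sz_k.
- by move=> lt_k; rewrite ltnW // ltnS -[X in _ <= X]ent_h; apply: tab_row.
- move=> r sz_r; rewrite ltnNge leq_eqVlt ltnS; apply/negP => /orP[/eqP ent_r|].
    have lt_r : size l1 < len t r.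
      by apply: leq_trans (tab_len_leS r tab_t); rewrite sz_r.
    have [A' def_A] : exists A', A = rcons A' (nth [::] t r).
      exists (take r A); rewrite def_t /upd nth_cat -sz_r ltnSn.
      by rewrite -take_nth ?sz_r ?take_size.
    move: eps0; rewrite def_A rev_rcons /= => eps0.
    have := count_sorted_le_eps_rec i (flatten (rev A')) (tab_sorted r tab_t).
    move/leq_trans/(_ (eps_rec_cat_ge i l2 _)); rewrite eps0 add0n leqNgt.
    move/negP; apply.
    apply: leq_trans (_ : count_mem i.+1 (drop (size l1) (nth [::] t r)) <= _).
      have -> : (count_mem i l2).+1 =
          count_mem i (drop (size l1) (nth [::] t (size A))).
        by rewrite row_h drop_size_cat //= eqxx.
      apply: (count_nth_le (x0 := 0)) => k; rewrite !size_drop !nth_drop.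
      rewrite !ltn_subRL => lt_k /= /eqP ent_k; rewrite -/(len _ _) in lt_k *.
      have lt_k' : size l1 + k < len t r.
        by apply: leq_trans (tab_len_leS r tab_t); rewrite sz_r.
      split=> //; rewrite eqn_leq -{1}ent_r (tab_row_le tab_t) ?leq_addr //=.
      rewrite -{1}ent_k; have := tab_col tab_t (r := r) (k := size l1 + k).
      by rewrite sz_r; apply.
    rewrite -{2}(cat_take_drop (size l1) (nth [::] t r)) count_cat.
    exact: leq_addl.
  apply/negP; rewrite -ltnNge -{1}ent_h -sz_r.
  by apply: tab_col; rewrite ?sz_r // -?ltnS //; lia.
- by move=> lt_k; rewrite ltnS ltnW // -[X in _ < X]ent_h; apply: tab_col.
Qed.

(** Here the critical neighbour is the one above. Were it [i], every [i.+1] of [l1] would lie below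
    an [i], so the row above would have more [i] than [l1] has [i.+1], against the ballot
    condition. *)
Lemma e_tableau_ex i t : 0 < i -> istab t -> 0 < eps_rec i (reading_word t) ->
  exists A B l1 l2, [/\ t = upd A B l1 l2 i.+1, istab (upd A B l1 l2 i) &
    f_tableau i (upd A B l1 l2 i) = Some t].
Proof.
move=> i0 tab_t /eps_rec_split [s1 [s2 [/reading_split]]].
move=> [A [B [l1 [l2 [def_t -> ->]]]]] bal eps0.
exists A, B, l1, l2; split => //; last by rewrite def_t f_tableau_upd.
have lt_h := size_lt_len_upd A B l1 l2 i.+1.
have ent_h := ent_upd_here A B l1 l2 i.+1.
have row_h := nth_upd A B l1 l2 i.+1.
rewrite -def_t in lt_h ent_h row_h; apply: (istab_upd (x := i.+1)); rewrite -?def_t //.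
- move=> k sz_k; rewrite ltnW // -ent_h -sz_k.
  by apply: tab_row; rewrite ?sz_k.
- move=> lt_k; rewrite -ltnS ltn_neqAle -{2}ent_h tab_row // andbT.
  (* A left neighbour [i.+1] would be the first letter of [l2], hence uncancelled. *)
  apply: contra_eq_neq eps0; rewrite /ent row_h.
  rewrite nth_cat ltnNge leqnSn /= subSn // subnn /=.
  move: lt_k; rewrite /len row_h size_cat /=; case: (l2) => [|y l] /=; first by lia.
  by move=> _ ->; rewrite eqxx.
- move=> r sz_r; rewrite -sz_r in lt_h ent_h.
  by apply: ltn_trans (ltnSn i) _; rewrite -{1}ent_h; apply: tab_col.
- move=> lt_b; have ent_b := tab_col tab_t lt_b.
  rewrite ent_h ltnS in ent_b; rewrite ltn_neqAle ent_b andbT.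
  apply/eqP => ent_i.
  have [B' def_B] : exists B', B = nth [::] t (size A).+1 :: B'.
    have := len_gt_size lt_b; rewrite def_t /upd size_cat /= addnS ltnS.
    rewrite nth_cat [X in if X then _ else _]ltnNge leqnSn /= subSn // subnn /=.
    by case: (B) => [|b B'] /=; [rewrite addn0 ltnn | exists B'].
  have srt := tab_sorted (size A).+1 tab_t.
  move: bal; rewrite def_B rev_cons flatten_rcons -catA.
  move/ballot_catr/(ballot_sorted_count srt).
  set b := nth [::] t (size A).+1 in def_B srt *.
  have mem_i : i \in b by rewrite -ent_i; apply: mem_nth.
  move/(_ mem_i); apply/negP; rewrite -ltnNge.
  apply: (@leq_ltn_trans (count_mem i (take (size l1) b))); last first.
    rewrite -{2}(cat_take_drop (size l1) b) count_cat (drop_nth 0) //.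
    by rewrite -/(ent t _ _) ent_i /= eqxx -addSnnS leq_addr.
  apply: (count_nth_le (x0 := 0)) => k lt_k /= /eqP nth_k.
  rewrite size_takel ?(ltnW lt_b) // nth_take //; split => //.
  have ent_k : ent t (size A) k = i.+1 by rewrite /ent row_h nth_cat lt_k.
  rewrite eqn_leq -ltnS -{1}ent_k (tab_col tab_t) ?(ltn_trans lt_k) //=.
  by rewrite -{1}ent_i (tab_row_le tab_t) // ltnW.
Qed.

Definition bounded (b : nat -> nat) (t : tableau) :=
  forall r k, k < len t r -> ent t r k <= b r.

(** Rows above [r0] have bounds below [i], hence no [i] to change; in all other rows [i.+1] is
    allowed. *)
Lemma bounded_f_tableau i r0 b t t' :
  b r0 = i.+1 -> (forall r, r < r0 -> i < b r) ->
  (forall r, r0 < r -> b r < i) ->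
  bounded b t -> f_tableau i t = Some t' -> bounded b t'.
Proof.
move=> b_r0 b_lt b_gt bd_t /f_tableauP[A [B [l1 [l2 [def_t -> _ _]]]]] r k.
rewrite (len_upd _ _ _ _ _ i) (ent_upd _ _ _ _ i) -def_t => lt_k.
case: andP => [[/eqP er /eqP ek]|_]; last exact: bd_t.
have := bd_t _ _ lt_k; rewrite er ek def_t ent_upd_here.
case: (ltngtP (size A) r0) => [/b_lt //|/b_gt|-> _]; last by rewrite b_r0.
by move=> lt_b; rewrite leqNgt lt_b.
Qed.

Lemma reading_word_row t r : r < size t ->
  reading_word t = flatten (rev (drop r.+1 t)) ++
                   nth [::] t r ++ flatten (rev (take r t)).
Proof.
move=> lt_r; rewrite /reading_word -{1}(cat_take_drop r t) (drop_nth [::]) //.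
by rewrite rev_cat rev_cons cat_rcons flatten_cat.
Qed.

Lemma bounded_e_tableau i r0 b t : 0 < i ->
  b r0 = i.+1 -> (forall r, r0 < r -> b r < i) ->
  istab t -> bounded b t -> ~ bounded (fun r => if r == r0 then i else b r) t ->
  exists t0, [/\ istab t0, bounded b t0, forall r, len t0 r = len t r,
    f_tableau i t0 = Some t & sumn (reading_word t0) < sumn (reading_word t)].
Proof.
move=> i0 b_r0 b_gt tab_t bd_t nbd.
have mem_i1 : i.+1 \in nth [::] t r0.
  apply/negP => /negP ni1; apply: nbd => r k lt_k; have := bd_t r k lt_k.
  case: eqP => [er|//]; rewrite er b_r0 leq_eqVlt ltnS => /predU1P[ent_k|//].
  case/negP: ni1; rewrite -ent_k -er; exact: mem_nth.
have lt_r0 : r0 < size t.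
  by case: ltnP => // le_r0; rewrite nth_default in mem_i1.
have eps_gt0 : 0 < eps_rec i (reading_word t).
  have small x : x \in flatten (rev (drop r0.+1 t)) -> x < i.
    case/flattenP => row; rewrite mem_rev => /(nthP [::])[r _ <-].
    rewrite nth_drop => /(nthP 0)[k lt_k <-].
    by apply: leq_ltn_trans (bd_t _ _ lt_k) _; apply: b_gt; rewrite leq_addr.
  rewrite (reading_word_row lt_r0) eps_rec_cat0.
  - apply: leq_trans (count_sorted_le_eps_rec _ _ (tab_sorted r0 tab_t)).
    by rewrite -has_count has_pred1.
  - by apply/negP => /small; rewrite ltnn.
  - by apply/negP => /small; rewrite ltnNge leqnSn.
have [A [B [l1 [l2 [def_t tab_t0 f_t0]]]]] := e_tableau_ex i0 tab_t eps_gt0.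
exists (upd A B l1 l2 i); split => // [r k|r|].
- rewrite (len_upd _ _ _ _ _ i.+1) (ent_upd _ _ _ _ i.+1) -def_t => lt_k.
  case: andP => [[/eqP er /eqP ek]|_]; last exact: bd_t.
  by apply: leq_trans (bd_t _ _ lt_k); rewrite def_t er ek ent_upd_here.
- by rewrite (len_upd _ _ _ _ _ i.+1) -def_t.
- by rewrite def_t !reading_upd !sumn_cat /= ltn_add2l ltn_add2r.
Qed.

(** The common form of the induction step: [mu] only serves to make the descent from [F] to [F']
    terminate. *)
Lemma iter_saturate (T : Type) (f : T -> option T) (mu : T -> nat)
    (F' F : set T) : F' `<=` F ->
  (forall x y, F x -> f x = Some y -> F y) ->
  (forall x, F x -> ~ F' x -> exists y, [/\ F y, f y = Some x & mu y < mu x]) ->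
  forall x, F x <-> exists m y, F' y /\ iter m (obind f) (Some y) = Some x.
Proof.
move=> sub stable desc x; split=> [Fx|[m [y [F'y]]]].
  have [n] := ubnP (mu x); elim: n x Fx => // n IH x Fx /ltnSE le_n.
  have [F'x|nF'x] := pselect (F' x); first by exists 0, x.
  have [y [Fy fy lt_mu]] := desc x Fx nF'x.
  have [m [z [F'z def_y]]] := IH y Fy (leq_trans lt_mu le_n).
  by exists m.+1, z; rewrite /= def_y.
elim: m x => [|m IH] x /=; first by move=> [<-]; apply: sub.
by case E: (iter _ _ _) => [z|//] /=; apply: stable; apply: IH.
Qed.

Definition bounded_pairs (a b : nat -> nat) : set (tableau * tableau) :=
  [set x | [/\ istab x.1, istab x.2, forall r, len x.1 r = len x.2 r,
               bounded a x.1 & bounded b x.2]].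

Definition bump_at (b : nat -> nat) r0 v : nat -> nat :=
  fun r => if r == r0 then v else b r.

Lemma bounded_pairs_f_op_pos n r0 a b :
  b r0 = n.+1 -> (forall r, r < r0 -> n.+2 < b r) ->
  (forall r, r0 < r -> b r < n.+1) ->
  forall x, bounded_pairs a (bump_at b r0 n.+2) x <->
    exists m y, bounded_pairs a b y /\
                iter m (obind (f_op (Posz n.+1))) (Some y) = Some x.
Proof.
move=> b_r0 b_lt b_gt.
have c_r0 : bump_at b r0 n.+2 r0 = n.+2 by rewrite /bump_at eqxx.
have c_lt r : r < r0 -> n.+1 < bump_at b r0 n.+2 r.
  by rewrite /bump_at; case: eqP => // _ /b_lt /ltnW.
have c_gt r : r0 < r -> bump_at b r0 n.+2 r < n.+1.
  by rewrite /bump_at => lt_r; rewrite gtn_eqF ?b_gt.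
apply: (iter_saturate (mu := fun x => sumn (reading_word x.2))).
- move=> [S T] [tS tT eST bS bT]; split => //= r k /bT.
  by rewrite /bump_at; case: eqP => // ->; rewrite b_r0 => /leqW.
- move=> [S T] y [/= tS tT eST bS bT].
  case E: (f_tableau _ _) => [T'|] //= [<-]; split=> //=.
  + exact: f_tableau_istab tT E.
  + have [A [B [l1 [l2 [def_T -> _ _]]]]] := f_tableauP E.
    by move=> r; rewrite eST def_T; apply: len_upd.
  + exact: bounded_f_tableau c_r0 c_lt c_gt bT E.
- move=> [S T] [/= tS tT eST bS bT] nbd.
  have [|T0 [tT0 bT0 eT0 fT0 lt_T0]] := bounded_e_tableau (ltn0Sn n) c_r0 c_gt tT bT.
    move=> bT'; apply: nbd; split=> //= r k /bT'.
    by rewrite /bump_at; case: eqP => // ->; rewrite b_r0.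
  exists (S, T0); split=> //=; last by rewrite fT0.
  by split=> //= r; rewrite eT0.
Qed.

Lemma bounded_pairs_f_op_neg n r0 a b :
  a r0 = n.+1 -> (forall r, r < r0 -> n.+2 < a r) ->
  (forall r, r0 < r -> a r < n.+1) ->
  forall x, bounded_pairs (bump_at a r0 n.+2) b x <->
    exists m y, bounded_pairs a b y /\
                iter m (obind (f_op (Negz n))) (Some y) = Some x.
Proof.
move=> a_r0 a_lt a_gt.
have c_r0 : bump_at a r0 n.+2 r0 = n.+2 by rewrite /bump_at eqxx.
have c_lt r : r < r0 -> n.+1 < bump_at a r0 n.+2 r.
  by rewrite /bump_at; case: eqP => // _ /a_lt /ltnW.
have c_gt r : r0 < r -> bump_at a r0 n.+2 r < n.+1.
  by rewrite /bump_at => lt_r; rewrite gtn_eqF ?a_gt.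
apply: (iter_saturate (mu := fun x => sumn (reading_word x.1))).
- move=> [S T] [tS tT eST bS bT]; split => //= r k /bS.
  by rewrite /bump_at; case: eqP => // ->; rewrite a_r0 => /leqW.
- move=> [S T] y [/= tS tT eST bS bT].
  case E: (f_tableau _ _) => [S'|] //= [<-]; split=> //=.
  + exact: f_tableau_istab tS E.
  + have [A [B [l1 [l2 [def_S -> _ _]]]]] := f_tableauP E.
    by move=> r; rewrite -eST def_S; apply: len_upd.
  + exact: bounded_f_tableau c_r0 c_lt c_gt bS E.
- move=> [S T] [/= tS tT eST bS bT] nbd.
  have [|S0 [tS0 bS0 eS0 fS0 lt_S0]] := bounded_e_tableau (ltn0Sn n) c_r0 c_gt tS bS.
    move=> bS'; apply: nbd; split=> //= r k /bS'.
    by rewrite /bump_at; case: eqP => // ->; rewrite a_r0.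
  exists (S0, T); split=> //=; last by rewrite fS0.
  by split=> //= r; rewrite eS0.
Qed.

(** * The operator with index 0 *)

(* [sesquilinear.Dot] shadows the sign. *)
Local Notation Dot := Defs.Dot.

(* With these letters f_1 changes the leftmost uncancelled letter 1, as f_0
   changes the first uncancelled + of a signature listed from right to left. *)
Definition sign_letter (a : sign) : nat :=
  match a with Plus => 1 | Minus => 2 | Dot => 0 end.

Definition sign_word (sg : seq sign) : seq nat := map sign_letter sg.

(** * Cancellation of signs as cancellation of letters *)

Definition undotted (sg : seq sign) : nat := count (predC is_dot) sg.

Lemma cancel_minus sg b : is_minus (nth Dot sg b) ->
  (forall k, k < b -> is_dot (nth Dot sg k)) ->
  let sg' := set_nth Dot sg b Dot in
  [/\ eps_rec 1 (sign_word sg) = (eps_rec 1 (sign_word sg')).+1,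
      fpos 1 (sign_word sg) = fpos 1 (sign_word sg'),
      size sg = size sg' & undotted sg = (undotted sg').+1].
Proof.
elim: sg b => [|a sg IH] [|b] //=; first by case: a.
move=> minus dots; have := dots 0 isT; case: a {dots} (dots) => //= dots _.
have [] := IH b minus; first by move=> k lt_k; apply: (dots k.+1).
by move=> -> -> -> ->.
Qed.

(** The pair is a letter 1 followed, up to neutral letters, by a letter 2, which [eps_rec] cancels
    anyway. *)
Lemma cancel_plus_minus sg a b : a < b ->
  is_plus (nth Dot sg a) -> is_minus (nth Dot sg b) ->
  (forall k, a < k < b -> is_dot (nth Dot sg k)) ->
  let sg' := set_nth Dot (set_nth Dot sg a Dot) b Dot in
  [/\ eps_rec 1 (sign_word sg) = eps_rec 1 (sign_word sg'),
      fpos 1 (sign_word sg) = fpos 1 (sign_word sg'),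
      size sg = size sg' & undotted sg = (undotted sg').+2].
Proof.
elim: sg a b => [|c sg IH] [|a] [|b] //=.
  case: c => // _ _ minus dots; have [] := cancel_minus minus.
    by move=> k lt_k; apply: (dots k.+1).
  by move=> -> -> -> ->; split.
rewrite ltnS => lt_ab plus minus dots.
have [] := IH a b lt_ab plus minus; first by move=> k lt_k; apply: (dots k.+1).
by move=> e1 e2 -> e3; rewrite e1 e2; split=> //; rewrite /undotted /= -/(undotted _) e3 !addnS.
Qed.

Lemma cancellableP sg a b : reflect
  [/\ a < b, is_plus (nth Dot sg a), is_minus (nth Dot sg b) &
      forall k, a < k < b -> is_dot (nth Dot sg k)] (cancellable sg (a, b)).
Proof.
apply: (iffP and4P) => /= -[lt_ab plus minus dots]; split => //.
  move=> k lt_k; apply: (allP dots); rewrite mem_iota; lia.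
by apply/allP => k; rewrite mem_iota => lt_k; apply: dots; lia.
Qed.

Lemma cancel_step_id sg :
  (forall p, ~~ cancellable sg p) -> cancel_step sg = sg.
Proof.
move=> canc; rewrite /cancel_step (eq_filter (a2 := pred0)) ?filter_pred0 //.
by move=> p; apply/negbTE.
Qed.

Lemma cancel_stepP sg :
  (forall p, ~~ cancellable sg p) \/
  [/\ fpos 1 (sign_word sg) = fpos 1 (sign_word (cancel_step sg)),
      size sg = size (cancel_step sg) &
      undotted sg = (undotted (cancel_step sg)).+2].
Proof.
rewrite /cancel_step; case E: (seq.filter _ _) => [|[a b] ps]; [left|right].
  move=> [a b]; apply/negP => canc; have [lt_ab _ minus _] := cancellableP _ _ _ canc.
  have lt_b : b < size sg by case: ltnP minus => // ?; rewrite nth_default.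
  suff : (a, b) \in [::] by []; rewrite -E mem_filter canc.
  by apply: allpairs_f; rewrite mem_iota //= (ltn_trans lt_ab).
have : (a, b) \in (a, b) :: ps by rewrite mem_head.
rewrite -E mem_filter => /andP[/cancellableP[lt_ab plus minus dots] _].
by have [] := cancel_plus_minus lt_ab plus minus dots.
Qed.

(** A sign strictly in between forms with one of the two ends a [Plus] before a [Minus] at smaller
    distance. *)
Lemma ex_cancellable sg a b : a < b ->
  is_plus (nth Dot sg a) -> is_minus (nth Dot sg b) ->
  exists p, cancellable sg p.
Proof.
have [n] := ubnP (b - a); elim: n a b => // n IH a b /ltnSE le_n lt_ab plus minus.
have [/allP dots|/allPn[k]] := boolP (all (fun k => is_dot (nth Dot sg k))
                                         (iota a.+1 (b - a.+1))).
  exists (a, b); apply/cancellableP; split=> // k lt_k; apply: dots.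
  by rewrite mem_iota; lia.
rewrite mem_iota subnKC // => /andP[lt_ak lt_kb]; case E: (nth Dot sg k) => // _.
  by apply: (IH k b); rewrite ?E ?(leq_trans _ le_n) ?ltn_sub2l.
by apply: (IH a k); rewrite ?E ?(leq_trans _ le_n) ?ltn_sub2r.
Qed.

Lemma eps_rec_eq0 i s : i.+1 \notin s -> eps_rec i s = 0.
Proof.
elim: s => //= b s IH; rewrite in_cons negb_or eq_sym => /andP[/negPf-> /IH->].
by case: ifP.
Qed.

Lemma fpos_uncancellable sg : (forall p, ~~ cancellable sg p) ->
  fpos 1 (sign_word sg) = find is_plus sg.
Proof.
move=> canc; have {canc} : forall a b, a < b ->
    is_plus (nth Dot sg a) -> ~~ is_minus (nth Dot sg b).
  move=> a b lt_ab plus; apply/negP => minus.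
  by have [p] := ex_cancellable lt_ab plus minus; apply/negP.
elim: sg => //= c sg IH H; rewrite IH; last by move=> a b lt_ab; apply: (H a.+1 b.+1).
case: c H => H //=.
rewrite eps_rec_eq0 //; apply/negP => /(nthP 0)[b]; rewrite size_map => lt_b.
by rewrite (nth_map Dot) //; have /= := H 0 b.+1 isT isT; case: (nth Dot _ _).
Qed.

Lemma find_reduced_signature sg :
  find is_plus (reduced_signature sg) = fpos 1 (sign_word sg) /\
  size (reduced_signature sg) = size sg.
Proof.
(* After [n] steps either nothing is cancellable or [2n] signs are gone; for [n = size sg] the
   second case forces [sg] to be empty. *)
have step n : let sg' := iter n cancel_step sg in
    [/\ fpos 1 (sign_word sg') = fpos 1 (sign_word sg), size sg' = size sg &
        (forall p, ~~ cancellable sg' p) \/ undotted sg' + n.*2 <= undotted sg].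
  elim: n => [|n [IH1 IH2 IH3]] /=; first by split=> //; right; rewrite addn0.
  set sg' := iter n cancel_step sg in IH1 IH2 IH3 *.
  case: (cancel_stepP sg') => [canc|[<- <- eqc]].
    by rewrite cancel_step_id //; split=> //; left.
  split=> //; case: IH3 => [canc|le_c]; last by right; rewrite doubleS; lia.
  by move: eqc; rewrite cancel_step_id // => /eqP; rewrite ltn_eqF // ltnW.
rewrite /reduced_signature; have [<- -> canc] := step (size sg).
split=> //; rewrite fpos_uncancellable //; case: canc => // le_c.
have := leq_trans le_c (count_size _ _); case: (sg) => //= [|c s]; last by lia.
by move=> _ [a [|b]]; apply/cancellableP => -[].
Qed.

Lemma f_zeroE x (c := fpos 1 (sign_word (signature x))) :
  f_zero x = if c < size (signature x)
             then Some (add_on_top c x.1, add_on_top c x.2) else None.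
Proof. by rewrite /f_zero; have [-> ->] := find_reduced_signature (signature x). Qed.

(** * Columns and their signs *)

Definition has_one (t : tableau) c := 1 \in column t c.

Lemma has_oneP t c :
  reflect (exists2 r, c < len t r & ent t r c = 1) (has_one t c).
Proof.
apply: (iffP mapP) => [[row]|[r lt_c ent_c]].
  rewrite mem_filter => /andP[lt_c /(nthP [::])[r _ def_row]] e1.
  by exists r; rewrite /len /ent def_row.
exists (nth [::] t r); last by rewrite -ent_c.
by rewrite mem_filter lt_c mem_nth // (len_gt_size lt_c).
Qed.

Lemma size_column t c : size (column t c) = count (fun row => c < size row) t.
Proof. by rewrite size_map size_filter. Qed.

(** Row lengths decrease upwards, so the rows meeting a column form an initial segment, and the
    column height is the index of the first row that is too short. *)
Lemma ltn_size_column t c r : istab t -> (r < size (column t c)) = (c < len t r).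
Proof.
move=> tab_t; set p := fun row : seq nat => c < size row.
have p_le s1 s2 : s1 <= s2 -> p (nth [::] t s2) -> p (nth [::] t s1).
  by move=> le_s lt_c; apply: leq_trans (tab_len_le tab_t le_s).
have -> : size (column t c) = find (predC p) t.
  set h := find _ _; have le_h : h <= size t by apply: find_size.
  rewrite size_column -(cat_take_drop h t) count_cat.
  rewrite (_ : count _ (take h t) = h).
    apply/eqP; rewrite -[X in _ == X]addn0 eqn_add2l eqn0Ngt -has_count.
    apply/negP => /(has_nthP [::])[s]; rewrite size_drop nth_drop => lt_s.
    move/(p_le _ _ (leq_addr s h)); apply/negP.
    apply: (@nth_find _ [::] (predC p)); rewrite has_find -/h; lia.
  rewrite -[RHS](size_takel le_h); apply/eqP; rewrite -all_count.
  apply/(all_nthP [::]) => s; rewrite size_takel // => lt_s.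
  by rewrite nth_take //; apply: negbFE; apply: (before_find [::] lt_s).
apply/idP/idP => [lt_r|lt_c]; first exact/negbFE/(before_find [::] lt_r).
rewrite ltnNge; apply/negP => le_r.
have := p_le _ _ le_r lt_c; apply/negP; apply: (@nth_find _ [::] (predC p)).
rewrite has_find; apply: leq_ltn_trans le_r _; exact: len_gt_size lt_c.
Qed.

Lemma smallest_gt1 s : ~~ nilp s -> all (fun x => 0 < x) s ->
  (1 < Defs.smallest s) = (1 \notin s).
Proof.
move=> ns pos_s.
have -> : (1 < Defs.smallest s) = (1 < head 0 s) && all (fun x => 1 < x) s.
  rewrite /Defs.smallest; elim: (s) (head 0 s) => [|x s' IH] h /=; first by rewrite andbT.
  by rewrite leq_min IH andbCA.
rewrite -has_pred1 -all_predC; apply/andP/allP => [[_ /allP gt1] x /gt1 /=|ne1].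
  by move=> gt1x; apply: contraL gt1x => /eqP ->.
have gt1 x : x \in s -> 1 < x.
  by move=> xs; rewrite ltn_neqAle (allP pos_s) // andbT eq_sym; apply: ne1.
split; last exact/allP.
by case: (s) ns gt1 => //= x s' _; apply; rewrite mem_head.
Qed.

Lemma smallest_eq1 s : ~~ nilp s -> all (fun x => 0 < x) s ->
  (Defs.smallest s == 1) = (1 \in s).
Proof.
move=> ns pos_s; have := smallest_gt1 ns pos_s.
suff s0 : 0 < Defs.smallest s.
  by move=> e; rewrite -[RHS]negbK -e ltn_neqAle s0 andbT negbK eq_sym.
rewrite /Defs.smallest; have : 0 < head 0 s by case: (s) ns pos_s => //= x s' _ /andP[].
by elim: (s) pos_s (head 0 s) => //= x s' IH /andP[x0 /IH{}IH] h h0; rewrite leq_min x0 IH.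
Qed.

Lemma column_pos t c : istab t -> all (fun x => 0 < x) (column t c).
Proof.
move=> tab_t; apply/allP => _ /mapP[row + ->].
rewrite mem_filter => /andP[lt_c /(nthP [::])[r _ def_row]].
by rewrite -def_row; apply: tab_pos => //; rewrite /len def_row.
Qed.

Lemma nilp_column t c : istab t -> nilp (column t c) = (len t 0 <= c).
Proof. by move=> tab_t; rewrite leqNgt -ltn_size_column // -leqNgt leqn0. Qed.

(** Entries being positive, a sign depends only on which of the two columns contain a 1; an empty
    column contains none and gets the letter of [Plus] without a separate case. *)
Definition one_letter (p q : bool) := if p && q then 2 else (~~ p && ~~ q : nat).

Lemma column_sign_letter S T c : istab S -> istab T ->
  (forall r, len S r = len T r) ->
  sign_letter (column_sign (S, T) c) = one_letter (has_one S c) (has_one T c).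
Proof.
move=> tS tT eST; rewrite /column_sign /= /has_one.
have nST : nilp (column T c) = nilp (column S c) by rewrite !nilp_column // eST.
case: (boolP (nilp (column S c))) nST => [nS nT|nS /negbT nT].
  by move: nS nT => /nilP -> /nilP ->.
rewrite !smallest_gt1 ?smallest_eq1 ?column_pos //.
by case: (1 \in _); case: (1 \in _).
Qed.

Section Pairs.
Variables S T : tableau.
Hypotheses (tS : istab S) (tT : istab T) (eST : forall r, len S r = len T r).

Definition letter c := one_letter (has_one S c) (has_one T c).

Lemma sign_word_signature :
  sign_word (signature (S, T)) = [seq letter c | c <- iota 0 (len S 0).+1].
Proof.
rewrite /sign_word /signature -map_comp.
rewrite (_ : size (head [::] (S, T).1) = len S 0); last by rewrite /len nth0.
by apply: eq_map => c; apply: column_sign_letter.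
Qed.

End Pairs.

(** * Adding and removing a box at the top of a column *)

Section AddOnTop.
Variables (t : tableau) (c : nat).
Hypotheses (tab_t : istab t) (len_c : len t (size (column t c)) = c).
Hypothesis no_one : ~~ has_one t c.
Local Notation h := (size (column t c)).

Lemma len_add r : len (add_on_top c t) r = if r == h then c.+1 else len t r.
Proof.
rewrite /len /add_on_top nth_set_nth /=; case: eqP => // _.
by rewrite size_set_nth -/(len t h) len_c; lia.
Qed.

Lemma ent_add r k : ent (add_on_top c t) r k =
  if (r == h) && (k == c) then 1 else ent t r k.
Proof.
rewrite /ent /add_on_top nth_set_nth /=; case: eqP => [->|//] /=.
by rewrite nth_set_nth /=.
Qed.

(** [len_c] makes the new box extend its row by one place; [no_one] keeps the column strict under
    the new 1. *)
Lemma istab_add : istab (add_on_top c t).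
Proof.
split=> [r k|r k|r k|r].
- rewrite len_add ent_add; case: eqP => [->|_] /=; last exact: tab_pos.
  case: eqP => // nk lt_k; apply: tab_pos => //; rewrite len_c; lia.
- rewrite len_add !ent_add; case: eqP => [->|_] /=; last exact: tab_row.
  rewrite ltnS leq_eqVlt => /predU1P[ek|lt_k].
    rewrite ek eqxx (_ : (k == c) = false); last by apply/eqP; lia.
    by apply: tab_pos; rewrite // len_c; lia.
  by rewrite !ltn_eqF ?(ltnW lt_k) //; apply: tab_row; rewrite // len_c.
- rewrite len_add !ent_add.
  case: (eqVneq r.+1 h) => [er|nr] /=.
    rewrite ltnS leq_eqVlt => le_k.
    rewrite (_ : (r == h) = false) /=; last by apply/eqP; lia.
    have lt_c : c < len t r by rewrite -ltn_size_column // -er.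
    case/predU1P: le_k => [->|lt_k]; last first.
      by rewrite ltn_eqF //; apply: tab_col; rewrite // er len_c.
    rewrite eqxx ltn_neqAle tab_pos // andbT eq_sym.
    by apply: contraNneq no_one => e1; apply/has_oneP; exists r.
  move=> lt_k; case: andP => [[/eqP er /eqP ek]|_]; last exact: tab_col.
  have := leq_trans lt_k (tab_len_leS r tab_t).
  by rewrite er ek len_c ltnn.
- rewrite len_add /add_on_top size_set_nth leq_max.
  case: eqP => // nr /orP[lt_r|]; last exact: tab_ne.
  have lt_rh : r < h by rewrite ltn_neqAle -ltnS lt_r andbT; apply/eqP.
  by rewrite ltn_size_column // in lt_rh; apply: leq_trans lt_rh.
Qed.

End AddOnTop.

(** Otherwise columns [c] and [c - 1] have the same height. Entries of column [c - 1] stand to the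
    right, so are at least those of column [c]; having no 1 passes to column [c - 1], which would be
    a [Plus] too, against [fposP]. *)
Lemma len_add_on_top S T c : istab S -> istab T ->
  (forall r, len S r = len T r) -> letter S T c = 1 ->
  (forall b, b.+1 = c -> letter S T b != 1) -> len S (size (column S c)) = c.
Proof.
move=> tS tT eST; set h := size (column S c) => l_c prev.
have le_c : len S h <= c by rewrite leqNgt -ltn_size_column // ltnn.
apply/eqP; rewrite eqn_leq le_c /= leqNgt; apply/negP => lt_h.
case: c => [|b] in h l_c prev le_c lt_h *; first by [].
have none t : istab t -> (forall r, len S r = len t r) ->
    ~~ has_one t b.+1 -> ~~ has_one t b.
  move=> tt et; apply: contra => /has_oneP[r lt_b ent_b]; apply/has_oneP.
  have lt_r : r < h.
    rewrite ltnNge; apply/negP => /(tab_len_le tS).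
    rewrite !et => /(leq_trans lt_b) lt_bh.
    by move: lt_h; rewrite ltnS et leqNgt lt_bh.
  rewrite ltn_size_column // et in lt_r; exists r => //; apply/eqP.
  by rewrite eqn_leq tab_pos // andbT -ent_b tab_row.
have := prev b erefl; move: l_c; rewrite /letter /one_letter.
case: (boolP (has_one S b.+1)) => [_|/(none _ tS (fun _ => erefl))/negPf ->].
  by case: has_one.
by case: (boolP (has_one T b.+1)) => [_|/(none _ tT eST)/negPf ->].
Qed.

Lemma eq_of_ltn m n : (forall s, (s < m) = (s < n)) -> m = n.
Proof. by move=> H; apply/eqP; rewrite eqn_leq leqNgt H ltnn leqNgt -H ltnn. Qed.

(** The last entry of the list is the leftmost box. A row of length 1 is cut off together with
    whatever follows it, as [istab] forbids empty rows; with [len_rS] nothing does follow. *)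
Definition del_top (r : nat) (t : tableau) : tableau :=
  if 1 < len t r
  then set_nth [::] t r (take (len t r).-1 (nth [::] t r)) else take r t.

Section DelTop.
Variables (t : tableau) (r c : nat).
Hypotheses (tab_t : istab t) (len_r : len t r = c.+1).
Hypothesis len_rS : len t r.+1 <= c.

Lemma len_del s : len (del_top r t) s = if s == r then c else len t s.
Proof.
rewrite /len /del_top len_r ltnS /=; case: ltnP => [c0|].
  by rewrite nth_set_nth /=; case: eqP => // _; rewrite size_takel -/(len t r) ?len_r.
rewrite leqn0 => /eqP c0; case: (ltnP s r) => [lt_s|le_r].
  by rewrite nth_take // ltn_eqF.
rewrite [in LHS]nth_default /=; last by rewrite size_take_min; apply: leq_trans (geq_minl _ _) le_r.
case: eqP => [//|nr]; apply/esym/eqP; rewrite -leqn0 -c0.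
by apply: leq_trans len_rS; apply: tab_len_le => //; lia.
Qed.

Lemma ent_del s k : k < len (del_top r t) s -> ent (del_top r t) s k = ent t s k.
Proof.
rewrite len_del => lt_k; rewrite /ent /del_top len_r ltnS /=.
case: (ltnP 0 c) => [c0|].
  by rewrite nth_set_nth /=; case: eqP lt_k => [-> lt_k|//]; rewrite nth_take.
rewrite leqn0 => /eqP c0; move: lt_k; case: eqP => [_|nr lt_k]; first by rewrite c0.
rewrite nth_take // ltnNge; apply/negP => le_r.
have le_rS : r < s by rewrite ltn_neqAle le_r andbT eq_sym; apply/eqP.
have := leq_trans lt_k (leq_trans (tab_len_le tab_t le_rS) len_rS).
by rewrite c0.
Qed.

Lemma len_del_le s : len (del_top r t) s <= len t s.
Proof. by rewrite len_del; case: eqP => // ->; rewrite len_r. Qed.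

Lemma istab_del : istab (del_top r t).
Proof.
have col s : len (del_top r t) s.+1 <= len (del_top r t) s.
  rewrite !len_del; case: (eqVneq s r) => [->|_]; first by rewrite gtn_eqF.
  case: eqP => [er|_]; last exact: tab_len_leS.
  by rewrite ltnW // -len_r -er; apply: tab_len_leS.
split=> [s k lt_k|s k lt_k|s k lt_k|s].
- by rewrite ent_del //; apply: tab_pos => //; apply: leq_trans (len_del_le s).
- rewrite !ent_del //; last exact: ltnW.
  by apply: tab_row => //; apply: leq_trans (len_del_le s).
- rewrite !ent_del //; last exact: leq_trans (col s).
  by apply: tab_col => //; apply: leq_trans (len_del_le s.+1).
- rewrite len_del /del_top len_r ltnS; have lt_r : r < size t.
    by apply: (@len_gt_size t r 0); rewrite len_r.
  case: (ltnP 0 c) => [c0|_].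
    rewrite size_set_nth (maxn_idPr lt_r) => lt_s.
    by case: eqP => // _; apply: tab_ne.
  rewrite size_takel ?(ltnW lt_r) // => lt_s; rewrite ltn_eqF //.
  by apply: tab_ne => //; apply: ltn_trans lt_r.
Qed.

Lemma size_column_del : size (column (del_top r t) c) = r.
Proof.
apply: eq_of_ltn => s.
rewrite ltn_size_column; last exact: istab_del.
  rewrite len_del; case: (ltngtP s r) => [lt_s|gt_s|_]; last by rewrite ltnn.
    by rewrite -len_r; apply: tab_len_le => //; apply: ltnW.
  by apply/negbTE; rewrite -leqNgt (leq_trans _ len_rS) // tab_len_le.
Qed.

Hypothesis ent_c : ent t r c = 1.

(** A 1 can only be the top entry of its column, so column [c] loses its only 1 and other columns
    lose nothing. *)
Lemma has_one_del b : has_one (del_top r t) b = (b != c) && has_one t b.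
Proof.
apply/has_oneP/andP => [[s lt_s ent_s]|[ne_b /has_oneP[s lt_s ent_s]]].
  have lt_s' := leq_trans lt_s (len_del_le s); rewrite ent_del // in ent_s.
  split; last by apply/has_oneP; exists s.
  apply: contraTneq lt_s => eb; rewrite -leqNgt len_del eb; case: eqP => // nr.
  rewrite leqNgt; apply/negP => lt_c; rewrite eb in ent_s.
  have lt_sr : s < r.
    rewrite ltn_neqAle leqNgt; apply/andP; split; first exact/eqP.
    apply/negP => /(tab_len_le tab_t)/leq_trans/(_ len_rS).
    by rewrite leqNgt lt_c.
  have lt_cS : c < len t s.+1 by rewrite -len_r; apply: tab_len_le.
  have := tab_col tab_t lt_cS; rewrite ent_s ltnS leqn0.
  by have := tab_pos tab_t lt_cS; case: (ent _ _ _).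
have lt_b : b < len (del_top r t) s.
  rewrite len_del; case: eqP lt_s => // ->; rewrite len_r ltnS leq_eqVlt.
  by rewrite (negPf ne_b).
by exists s; rewrite // ent_del.
Qed.

Lemma add_del : add_on_top c (del_top r t) = t.
Proof.
have no_one : ~~ has_one (del_top r t) c by rewrite has_one_del eqxx.
have len_h : len (del_top r t) (size (column (del_top r t) c)) = c.
  by rewrite size_column_del len_del eqxx.
have eq_len s : len (add_on_top c (del_top r t)) s = len t s.
  by rewrite len_add // size_column_del len_del; case: eqP => // ->.
apply: tab_ext => //; first by apply: istab_add => //; apply: istab_del.
move=> s k lt_k; rewrite ent_add // size_column_del.
case: andP => [[/eqP -> /eqP ->] //|nsk]; rewrite ent_del // len_del.
case: eqP => // er; rewrite ltn_neqAle -ltnS -len_r -er lt_k andbT.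
by apply/negP => ek; apply: nsk; rewrite er eqxx.
Qed.

End DelTop.

Lemma letter_eq1 S T c : letter S T c = 1 -> ~~ has_one S c /\ ~~ has_one T c.
Proof. by rewrite /letter /one_letter; case: has_one; case: has_one. Qed.

Lemma letter_eq2 S T c : letter S T c = 2 -> has_one S c /\ has_one T c.
Proof. by rewrite /letter /one_letter; case: has_one; case: has_one. Qed.

Lemma nth_map_iota (f : nat -> nat) n c : c < n ->
  nth 0 [seq f k | k <- iota 0 n] c = f c.
Proof. by move=> lt_c; rewrite (nth_map 0) ?size_iota // nth_iota. Qed.

Lemma map_iota_split (f : nat -> nat) n c : c < n ->
  [seq f k | k <- iota 0 n] =
  [seq f k | k <- iota 0 c] ++ f c :: [seq f k | k <- iota c.+1 (n - c.+1)].
Proof.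
move=> lt_c; rewrite -[in LHS](subnKC lt_c) -addn1 -addnA add1n.
by rewrite iotaD map_cat /= addn1 -addn1 add0n addn1.
Qed.

(** * The induction step for index 0 *)

Section FZero.
Variables (d : nat) (a b : nat -> nat).
Hypotheses (a_d : a d = 0) (b_d : b d = 0) (a_gt : forall r, d < r -> a r = 0).
Hypotheses (a_lt : forall r, r < d -> 0 < a r) (b_lt : forall r, r < d -> 0 < b r).
Local Notation F := (bounded_pairs (bump_at a d 1) (bump_at b d 1)).

Lemma bounded_pairs_f_zero_stable x y : F x -> f_zero x = Some y -> F y.
Proof.
case: x => S T [/= tS tT eST bS bT]; rewrite f_zeroE.
set c := fpos _ _; case: ltnP => // lt_c [<-].
have sw := sign_word_signature tS tT eST.
have sz : size (signature (S, T)) = size (sign_word (signature (S, T))).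
  by rewrite [RHS]size_map.
have [] := fposP (i := 1) (s := sign_word (signature (S, T))).
  by rewrite -sz.
have szN : size (signature (S, T)) = (len S 0).+1 by rewrite sz sw [LHS]size_map size_iota.
rewrite szN in lt_c; rewrite -/c sw nth_map_iota // => l_c _ prev.
have {}prev e : e.+1 = c -> letter S T e != 1.
  move=> e_c; have := prev e e_c; rewrite nth_map_iota //.
  by rewrite -ltnS e_c ltnW.
have len_S := len_add_on_top tS tT eST l_c prev.
have eq_h : size (column T c) = size (column S c).
  by apply: eq_of_ltn => s; rewrite !ltn_size_column // eST.
have len_T : len T (size (column T c)) = c by rewrite eq_h -eST.
have [nS nT] := letter_eq1 l_c.
(* A box in row [d] has bound 1, so it would put a 1 into a column marked [Plus]. *)
have le_h : size (column S c) <= d.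
  rewrite leqNgt ltn_size_column //; apply/negP => lt_cd; case/negP: nS.
  apply/has_oneP; exists d => //; apply/eqP; rewrite eqn_leq tab_pos // andbT.
  by have := bS d c lt_cd; rewrite /bump_at eqxx.
have bound1 e : (forall r, r < d -> 0 < e r) -> 0 < bump_at e d 1 (size (column S c)).
  by move=> e_lt; rewrite /bump_at; case: eqP => // /eqP nd; rewrite e_lt // ltn_neqAle nd.
split=> /=; try exact: istab_add.
- by move=> r; rewrite !len_add // eq_h eST.
- move=> r k; rewrite len_add // ent_add //.
  case: (eqVneq r (size (column S c))) => [->|_] /=; last exact: bS.
  case: eqP => [_ _|nk lt_k]; first exact: bound1.
  by apply: bS; rewrite len_S ltn_neqAle -ltnS lt_k andbT; apply/eqP.
- move=> r k; rewrite len_add // ent_add // eq_h.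
  case: (eqVneq r (size (column S c))) => [->|_] /=; last exact: bT.
  case: eqP => [_ _|nk lt_k]; first exact: bound1.
  by apply: bT; rewrite -eq_h len_T ltn_neqAle -ltnS lt_k andbT; apply/eqP.
Qed.

Lemma bounded_pairs_e_zero x : F x -> ~ bounded_pairs a b x ->
  exists y, [/\ F y, f_zero y = Some x &
    \sum_(r < d.+1) len y.1 r < \sum_(r < d.+1) len x.1 r].
Proof.
case: x => S T [/= tS tT eST bS bT] nF'.
have bd_d (t : tableau) e k : bounded (bump_at e d 1) t -> istab t -> k < len t d -> ent t d k = 1.
  move=> bt tt lt_k; apply/eqP; rewrite eqn_leq tab_pos // andbT.
  by have := bt d k lt_k; rewrite /bump_at eqxx.
have len_d : 0 < len S d.
  rewrite lt0n; apply/eqP => len_d0; apply: nF'.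
  have small t e : bounded (bump_at e d 1) t -> len t d = 0 -> bounded e t.
    by move=> bt t0 r k lt_k; have := bt r k lt_k; rewrite /bump_at;
       case: eqP => // er; rewrite er t0 in lt_k.
  by split=> //; [apply: small bS _ | apply: small bT _; rewrite -eST].
have len_dT : 0 < len T d by rewrite -eST.
(* Row [d] is nonempty with bound 1, so the rightmost column is a [Minus]. It is the first letter of
   the word, so nothing can cancel it. *)
have lS : has_one S 0 by apply/has_oneP; exists d => //; apply: bd_d bS tS len_d.
have lT : has_one T 0 by apply/has_oneP; exists d => //; apply: bd_d bT tT len_dT.
set N := (len S 0).+1.
set w := [seq letter S T k | k <- iota 0 N].
have w0 : 0 < eps_rec 1 w by rewrite /w /= {1}/letter lS lT.
have [s1 [s2 [def_w bal eps0]]] := eps_rec_split w0.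
set c := size s1.
have size_w : size w = N by rewrite size_map size_iota.
have lt_cN : c < N by rewrite -size_w def_w size_cat /= addnS ltnS leq_addr.
have w_split := map_iota_split (letter S T) lt_cN.
have [def_s1 [l_c def_s2]] : s1 = [seq letter S T k | k <- iota 0 c] /\
   (letter S T c = 2 /\ s2 = [seq letter S T k | k <- iota c.+1 (N - c.+1)]).
  move: def_w; rewrite /w w_split => /eqP; rewrite eqseq_cat ?size_map ?size_iota //.
  by rewrite eqseq_cons => /and3P[/eqP-> /eqP-> /eqP->].
have [/has_oneP[r lt_r ent_r] /has_oneP[r' lt_r' ent_r']] := letter_eq2 l_c.
have top t s : istab t -> ent t s c = 1 -> len t s.+1 <= c.
  move=> tt ent_s; rewrite leqNgt; apply/negP => lt_c.
  by have := tab_col tt lt_c; rewrite ent_s ltnS leqn0 gtn_eqF ?tab_pos.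
have lenS_rS := top _ _ tS ent_r; have lenT_rS := top _ _ tT ent_r'.
(* In both tableaux the 1 is the top entry of column [c], and the shapes agree. *)
have er : r' = r.
  have no_lt s s' : c < len S s' -> len S s.+1 <= c -> s' <= s.
    move=> lt_s' le_s; rewrite leqNgt; apply/negP => /(tab_len_le tS).
    by move/(leq_trans lt_s')/leq_trans/(_ le_s); rewrite ltnn.
  apply/eqP; rewrite eqn_leq; apply/andP; split.
    by apply: no_lt lenS_rS; rewrite eST.
  by apply: no_lt lt_r _; rewrite eST.
rewrite {r'}er in lt_r' ent_r' lenT_rS.
(* If row [r] went on, both columns [c.+1] would contain a 1, and [s2] would begin with an
   uncancelled 2. *)
have len_r : len S r = c.+1.
  apply/eqP; rewrite eqn_leq lt_r andbT leqNgt; apply/negP => lt_cS.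
  have one t : istab t -> ent t r c = 1 -> c.+1 < len t r -> has_one t c.+1.
    move=> tt ent_t lt_t; apply/has_oneP; exists r => //; apply/eqP.
    by rewrite eqn_leq tab_pos // andbT -ent_t tab_row.
  have lt_cSN : 0 < N - c.+1.
    rewrite subn_gt0 /N ltnS; apply: leq_trans (ltnW lt_cS) _.
    exact: tab_len_le.
  move: eps0; rewrite def_s2; case: (N - c.+1) lt_cSN => //= m _.
  by rewrite {1}/letter !one // -eST.
have len_rT : len T r = c.+1 by rewrite -eST.
have le_rd : r <= d.
  rewrite leqNgt; apply/negP => lt_dr; have := bS r c lt_r.
  by rewrite ent_r /bump_at gtn_eqF // a_gt.
exists (del_top r S, del_top r T).
have tS0 := istab_del tS len_r lenS_rS; have tT0 := istab_del tT len_rT lenT_rS.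
have eST0 s : len (del_top r S) s = len (del_top r T) s.
  by rewrite (len_del tS len_r) // (len_del tT len_rT) // eST.
have bdel t e : istab t -> len t r = c.+1 -> len t r.+1 <= c ->
    bounded e t -> bounded e (del_top r t).
  move=> tt lt le_t bt s k lt_k; rewrite (ent_del tt lt) //; apply: bt.
  by apply: leq_trans (len_del_le tt lt le_t s).
split => /=.
- by split=> //=; apply: bdel.
- rewrite f_zeroE.
  have l0 k : k != c -> letter (del_top r S) (del_top r T) k = letter S T k.
    move=> nk; rewrite /letter (has_one_del tS len_r) //.
    by rewrite (has_one_del tT len_rT) // nk.
  have l0c : letter (del_top r S) (del_top r T) c = 1.
    by rewrite /letter (has_one_del tS len_r) // (has_one_del tT len_rT) // eqxx.
  set N0 := (len (del_top r S) 0).+1.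
  have lt_cN0 : c < N0.
    by rewrite ltnS (len_del tS len_r) //; case: eqP.
  have szN0 : size (signature (del_top r S, del_top r T)) = N0.
    have := congr1 size (sign_word_signature tS0 tT0 eST0).
    by rewrite [LHS]size_map [RHS]size_map size_iota.
  suff -> : fpos 1 (sign_word (signature (del_top r S, del_top r T))) = c.
    by rewrite szN0 lt_cN0 !(add_del _ _ _ _).
  rewrite sign_word_signature // (map_iota_split _ lt_cN0) l0c fpos_ballot.
  + by rewrite size_map size_iota.
  + rewrite (_ : [seq _ | k <- _] = s1) // def_s1; apply/eq_in_map => k.
    by rewrite mem_iota add0n => /andP[_ lt_k]; rewrite l0 // ltn_eqF.
  (* For [r = 0] the bottom row shrinks to length [c], and the new signature stops at column [c]. *)
  + rewrite /N0 (len_del tS len_r) //; case: eqP => [_|_]; first by rewrite subnn.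
    rewrite -[RHS]eps0 def_s2; congr eps_rec; apply/eq_in_map => k; rewrite mem_iota => /andP[lt_k _].
    by rewrite l0 // gtn_eqF.
- have lt_rd : r < d.+1 by [].
  rewrite (bigD1 (Ordinal lt_rd)) // [X in _ < X](bigD1 (Ordinal lt_rd)) //=.
  rewrite -addSn; apply: leq_add; first by rewrite (len_del tS len_r) // eqxx len_r.
  by apply: leq_sum => s _; apply: (len_del_le tS len_r lenS_rS).
Qed.

Lemma bounded_pairs_f_zero x : F x <->
  exists m y, bounded_pairs a b y /\ iter m (obind (f_op (Posz 0))) (Some y) = Some x.
Proof.
move: x; apply: (iter_saturate (mu := fun x => \sum_(r < d.+1) len x.1 r)).
- move=> [S T] [tS tT eST bS bT]; split=> //= r k lt_k.
    by rewrite /bump_at; case: eqP (bS r k lt_k) => // ->; rewrite a_d => /leqW.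
  by rewrite /bump_at; case: eqP (bT r k lt_k) => // ->; rewrite b_d => /leqW.
- exact: bounded_pairs_f_zero_stable.
- exact: bounded_pairs_e_zero.
Qed.

End FZero.

(** * The action on nonzero integers *)

Lemma zleft_lt_right i : (val (zleft i) < val (zright i))%R.
Proof. by case: i => [[|n]|n] //=; rewrite ?NegzE; lia. Qed.

Lemma zleft_right_gap i (z : Zx) :
  (val z <= val (zleft i))%R || (val (zright i) <= val z)%R.
Proof.
case: z => v v0; rewrite [val (Sub _ _)]/=.
by case: i => [[|n]|n] /=; rewrite ?NegzE; lia.
Qed.

Lemma ztransp_lt i x y : ~ (x = zleft i /\ y = zright i) ->
  ~ (x = zright i /\ y = zleft i) ->
  (val (ztransp i x) < val (ztransp i y))%R = (val x < val y)%R.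
Proof.
move=> nlr nrl; rewrite /ztransp; have := zleft_lt_right i.
have := zleft_right_gap i x; have := zleft_right_gap i y.
have inj (z t : Zx) : z != t -> val z != val t by rewrite (inj_eq val_inj).
have [exl|/inj xl] := eqVneq x (zleft i).
  have [eyl|/inj yl] := eqVneq y (zleft i); first by subst x y; rewrite !ltxx.
  have [eyr|/inj yr] := eqVneq y (zright i); first by case: nlr.
  by subst x; lia.
have [exr|/inj xr] := eqVneq x (zright i).
  have [eyl|/inj yl] := eqVneq y (zleft i); first by case: nrl.
  have [eyr|/inj yr] := eqVneq y (zright i); first by subst x y; rewrite !ltxx.
  by subst x; lia.
have [eyl|/inj yl] := eqVneq y (zleft i); first by subst y; lia.
have [eyr|/inj yr] := eqVneq y (zright i); first by subst y; lia.
by lia.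
Qed.

Lemma ztransp_left i : ztransp i (zleft i) = zright i.
Proof. by rewrite /ztransp eqxx. Qed.

Lemma ztransp_right i : ztransp i (zright i) = zleft i.
Proof. by rewrite -[RHS](ztranspK i) ztransp_left. Qed.

Lemma ztransp_fix i z : z != zleft i -> z != zright i -> ztransp i z = z.
Proof. by rewrite /ztransp => /negPf-> /negPf->. Qed.

Lemma word_act_cat u v z : word_act (u ++ v) z = word_act u (word_act v z).
Proof. by elim: u => //= i u ->. Qed.

Lemma word_actK u : cancel (word_act u) (word_act (rev u)).
Proof.
by elim: u => //= i u IH z; rewrite rev_cons word_act_rcons /= ztranspK IH.
Qed.

Lemma word_actVK u : cancel (word_act (rev u)) (word_act u).
Proof. by move=> z; rewrite -{1}[u]revK word_actK. Qed.

Lemma word_act_inj u : injective (word_act u).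
Proof. exact: can_inj (word_actK u). Qed.

Lemma word_act_ztransp u i j : word_act u (zleft j) = zleft i ->
  word_act u (zright j) = zright i ->
  forall z, word_act u (ztransp j z) = ztransp i (word_act u z).
Proof.
move=> ul ur z; have [->|zl] := eqVneq z (zleft j).
  by rewrite ztransp_left ul ztransp_left.
have [->|zr] := eqVneq z (zright j); first by rewrite ztransp_right ur ztransp_right.
by rewrite !ztransp_fix // -?ul -?ur (inj_eq (@word_act_inj u)).
Qed.

(** Letters are applied from the right end of [u]; the order of the two images can flip only at a
    letter that exchanges precisely these images. *)
Lemma inversion_split u (x y : Zx) : (val x < val y)%R ->
  (val (word_act u y) < val (word_act u x))%R ->
  exists u1 i u2, [/\ u = u1 ++ i :: u2, word_act u2 x = zleft i &
                      word_act u2 y = zright i].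
Proof.
move=> lt_xy; elim: u => [|i u IH] /=; first by move=> /(lt_trans lt_xy); rewrite ltxx.
have [/IH [u1 [k [u2 [-> e1 e2]]]] _|] := ltP (val (word_act u y)) (val (word_act u x)).
  by exists (i :: u1), k, u2.
rewrite le_eqVlt (inj_eq val_inj) (inj_eq (@word_act_inj u)).
rewrite -(inj_eq val_inj) lt_eqF //= => lt_u.
have [[e1 e2] _|nlr] := pselect (word_act u x = zleft i /\ word_act u y = zright i).
  by exists [::], i, u.
have nrl : ~ (word_act u x = zright i /\ word_act u y = zleft i).
  by move=> [e1 e2]; move: lt_u; rewrite e1 e2 ltNge ltW ?zleft_lt_right.
by move=> lt_t; have := ztransp_lt nlr nrl; rewrite lt_u ltNge ltW.
Qed.

(** Since [u2 s_j = s_i u2], omitting the letter [i] found above multiplies by [s_j] on the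
    right. *)
Lemma exchange u j : (val (word_act u (zright j)) < val (word_act u (zleft j)))%R ->
  exists2 v, size v < size u & word_act v =1 word_act u \o ztransp j.
Proof.
move/(inversion_split (zleft_lt_right j)) => [u1 [i [u2 [-> ul ur]]]].
exists (u1 ++ u2) => [|z]; first by rewrite !size_cat /= addnS.
by rewrite /= !word_act_cat /= (word_act_ztransp ul ur) ztranspK.
Qed.

(* [u] is a reduced word of an element of W^{Lambda_0}, both properties being
   read off the action. *)
Definition grassmannian (u : seq int) : Prop :=
  (forall v, word_act v =1 word_act u -> size u <= size v) /\
  (forall j v, j != 0%R -> word_act v =1 word_act u \o ztransp j ->
     size u < size v).

Lemma grassmannian_tail i u : grassmannian (i :: u) -> grassmannian u.
Proof.
move=> [red min]; split=> [v uv|j v j0 uv].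
  by have := red (i :: v); rewrite /= ltnS; apply=> z /=; rewrite uv.
by have := min j (i :: v) j0; rewrite /= ltnS; apply=> z /=; rewrite uv.
Qed.

(** A descent at [j] would give, by exchange, a shorter word for the product with [s_j]. Hence the
    action is increasing on the negative and on the positive integers separately. *)
Lemma grassmannian_lt u j : grassmannian u -> j != 0%R ->
  (val (word_act u (zleft j)) < val (word_act u (zright j)))%R.
Proof.
move=> [_ min] j0; rewrite ltNge le_eqVlt (inj_eq val_inj).
rewrite (inj_eq (@word_act_inj u)) eq_sym (negPf (zleft_neq_right j)) /=.
apply/negP => /exchange [v lt_v /(min _ _ j0)].
by rewrite ltnNge ltnW.
Qed.

Definition npart u (r : nat) : int := val (word_act u (zneg r)).
Definition ppart u (r : nat) : int := val (word_act u (zpos r)).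

Lemma npart_lt u r s : grassmannian u -> r < s -> (npart u s < npart u r)%R.
Proof.
move=> gu; elim: s => // s IH; rewrite ltnS leq_eqVlt.
have step : (npart u s.+1 < npart u s)%R by apply: (grassmannian_lt (j := Negz s) gu).
by case/predU1P => [->|/IH]; [|apply: lt_trans].
Qed.

Lemma ppart_lt u r s : grassmannian u -> r < s -> (ppart u r < ppart u s)%R.
Proof.
move=> gu; elim: s => // s IH; rewrite ltnS leq_eqVlt.
have step : (ppart u s < ppart u s.+1)%R by apply: (grassmannian_lt (j := Posz s.+1) gu).
by case/predU1P => [->|/IH lt_r]; [|apply: lt_trans lt_r step].
Qed.

Lemma npart_ltE u : grassmannian u -> forall r s, (npart u r < npart u s)%R = (s < r).
Proof.
move=> gu r s; case: (ltngtP r s) => [lt_rs|/(npart_lt gu) ->//|->]; last by rewrite ltxx.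
by rewrite ltNge ltW // npart_lt.
Qed.

Lemma ppart_ltE u : grassmannian u -> forall r s, (ppart u r < ppart u s)%R = (r < s).
Proof.
move=> gu r s; case: (ltngtP r s) => [/(ppart_lt gu) ->//|lt_rs|->]; last by rewrite ltxx.
by rewrite ltNge ltW // ppart_lt.
Qed.

Lemma zx_cases (z : Zx) : (exists n, z = zneg n) \/ (exists n, z = zpos n).
Proof.
case: z => [[[|n]|n] z0]; last by left; exists n; apply: val_inj.
  by [].
by right; exists n; apply: val_inj.
Qed.

Lemma zneg_pos r s : zneg r != zpos s.
Proof. by rewrite -(inj_eq val_inj). Qed.

Lemma eq_zneg r s : (zneg r == zneg s) = (r == s).
Proof. by rewrite -(inj_eq val_inj) /= ; apply/eqP/eqP => [[]|->]. Qed.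

Lemma eq_zpos r s : (zpos r == zpos s) = (r == s).
Proof. by rewrite -(inj_eq val_inj) /= ; apply/eqP/eqP => [[]|->]. Qed.

Lemma grassmannian_cons_no_commute i u j : grassmannian (i :: u) -> j != 0%R ->
  word_act u (zleft j) = zleft i -> word_act u (zright j) = zright i -> False.
Proof.
move=> [_ min] j0 ul ur; have := min j u j0; rewrite /= ltnNge leqnSn.
by move=> F; apply: notF; apply: F => z /=; rewrite (word_act_ztransp ul ur) ztranspK.
Qed.

(** The other sign patterns of the two preimages fail. Equal signs make them consecutive by
    monotonicity, so [s_i] moves through [u] to some [s_j] with [j != 0]. A positive preimage of
    [zleft i] with a negative one of [zright i] lets exchange, applied to [rev u], shorten
    [i :: u]. *)
Lemma grassmannian_cons_neg_pos i u : grassmannian (i :: u) ->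
  exists p q, word_act u (zneg p) = zleft i /\ word_act u (zpos q) = zright i.
Proof.
move=> giu; have gu := grassmannian_tail giu.
have := word_actVK u (zleft i); have := word_actVK u (zright i).
have gap := zleft_right_gap i; have lr := zleft_lt_right i.
case: (zx_cases (word_act (rev u) (zleft i))) => -[p ep];
  case: (zx_cases (word_act (rev u) (zright i))) => -[q eq];
  rewrite ep eq => er el.
- have lt_qp : q < p by rewrite -(npart_ltE gu) /npart el er.
  have [lt_q1|] := ltnP q.+1 p.
    have := gap (word_act u (zneg q.+1)); rewrite -el -er.
    by have := npart_lt gu lt_q1; have := npart_lt gu (ltnSn q); rewrite /npart; lia.
  move=> le_p; have ep1 : p = q.+1 by apply/eqP; rewrite eqn_leq le_p.
  by case: (@grassmannian_cons_no_commute i u (Negz q) giu); rewrite //= -ep1.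
- by exists p, q.
- have [|v lt_v ev] := @exchange (rev u) i; first by rewrite ep eq.
  case: (giu) => red _; have := red (rev v); rewrite size_rev /= leqNgt ltnS.
  rewrite size_rev in lt_v; rewrite (ltnW lt_v) => F; case: notF; apply: F => z.
  rewrite -[RHS](word_actK v); congr word_act.
  by rewrite ev /= ztranspK word_actK.
- have lt_pq : p < q by rewrite -(ppart_ltE gu) /ppart el er.
  have [lt_p1|] := ltnP p.+1 q.
    have := gap (word_act u (zpos p.+1)); rewrite -el -er.
    by have := ppart_lt gu lt_p1; have := ppart_lt gu (ltnSn p); rewrite /ppart; lia.
  move=> le_q; have eq1 : q = p.+1 by apply/eqP; rewrite eqn_leq le_q.
  by case: (@grassmannian_cons_no_commute i u (Posz p.+1) giu); rewrite //= -eq1.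
Qed.

(** By the last clause at most one comparison changes: the one that adds to lambda(w) a box in row
    [p] and column [q], counted from 0. *)
Lemma grassmannian_cons i u : grassmannian (i :: u) ->
  exists p q, [/\ npart u p = val (zleft i), ppart u q = val (zright i),
    forall r, npart (i :: u) r = if r == p then val (zright i) else npart u r,
    forall r, ppart (i :: u) r = if r == q then val (zleft i) else ppart u r &
    forall m k, (m, k) <> (zpos q, p) ->
      (val (word_act (i :: u) m) < npart (i :: u) k)%R =
      (val (word_act u m) < npart u k)%R].
Proof.
move=> giu; have [p [q [ep eq]]] := grassmannian_cons_neg_pos giu.
have inj := inj_eq (@word_act_inj u).
exists p, q; split; rewrite /npart /ppart ?ep ?eq //.
- move=> r; case: eqP => [->|/eqP nr] /=; first by rewrite ep ztransp_left.
  by rewrite ztransp_fix // -?ep -?eq inj ?eq_zneg // zneg_pos.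
- move=> r; case: eqP => [->|/eqP nr] /=; first by rewrite eq ztransp_right.
  by rewrite ztransp_fix // -?ep -?eq inj ?eq_zpos // eq_sym zneg_pos.
- move=> m k ne /=; apply: ztransp_lt => -[/eqP + /eqP]; rewrite -ep -eq !inj.
    by move=> _; rewrite (negPf (zneg_pos _ _)).
  by move=> /eqP em; rewrite eq_zneg => /eqP ek; apply: ne; rewrite em ek.
Qed.

Lemma npart_neq0 u r : npart u r != 0%R.
Proof. by rewrite /npart; case: (word_act _ _). Qed.

Lemma ppart_neq0 u r : ppart u r != 0%R.
Proof. by rewrite /ppart; case: (word_act _ _). Qed.

Lemma npart_neq_ppart u r s : npart u r != ppart u s.
Proof.
by rewrite (inj_eq val_inj) (inj_eq (@word_act_inj u)) zneg_pos.
Qed.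

Lemma grassmannian_zero_step u p q : grassmannian u ->
  (forall r, (0 < npart u r)%R = (r < count_mem 0%R u)) ->
  (forall r, (ppart u r < 0)%R = (r < count_mem 0%R u)) ->
  npart u p = (- 1)%R -> ppart u q = 1%R ->
  p = count_mem 0%R u /\ q = count_mem 0%R u.
Proof.
set d := count_mem _ _ => gu nd pd np pq; split.
  have := nd p; rewrite np /= => /esym/negbT; rewrite -leqNgt leq_eqVlt.
  case/predU1P => [->//|/(npart_lt gu)]; have := nd d; rewrite ltnn np.
  by have := npart_neq0 u d; lia.
have := pd q; rewrite pq /= => /esym/negbT; rewrite -leqNgt leq_eqVlt.
case/predU1P => [->//|/(ppart_lt gu)]; have := pd d; rewrite ltnn pq.
by have := ppart_neq0 u d; lia.
Qed.

(** For [i != 0] the exchanged values have equal signs. For [i = 0] they are -1 and 1, which by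
    monotonicity sit at the first index of unchanged sign in each family; so each letter 0 flips one
    more index. *)
Lemma part_sign u : grassmannian u ->
  (forall r, (0 < npart u r)%R = (r < count_mem 0%R u)) /\
  (forall r, (ppart u r < 0)%R = (r < count_mem 0%R u)).
Proof.
elim: u => [|i u IH] giu; first by split.
have gu := grassmannian_tail giu; have [nd pd] := IH gu.
have [p [q [np pq step_n step_p _]]] := grassmannian_cons giu.
case: (eqVneq i 0%R) => [ei|ni].
  rewrite ei in np pq step_n step_p *.
  have [ep eq] := grassmannian_zero_step gu nd pd np pq.
  split=> r; rewrite ?step_n ?step_p /= ?eqxx add1n ltnS leq_eqVlt.
    by rewrite ep; case: (eqVneq r _) => // _; apply: nd.
  by rewrite eq; case: (eqVneq r _) => // _; apply: pd.
have cnt : count_mem 0%R (i :: u) = count_mem 0%R u by rewrite /= (negPf ni).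
split=> r; rewrite cnt ?step_n ?step_p.
  case: eqP => [->|_]; last exact: nd.
  by rewrite -nd np; case: (i) ni => [[|n]|n].
case: eqP => [->|_]; last exact: pd.
by rewrite -pd pq; case: (i) ni => [[|n]|n].
Qed.

(** * Demazure crystals as sets of bounded pairs *)

(** The positive part of w(-(r + 1)), which bounds the second component; [pbound] takes the negative
    part of w(r + 1) and bounds the first. *)
Definition nbound u r : nat := if npart u r is Posz n then n else 0.
Definition pbound u r : nat := if ppart u r is Negz n then n.+1 else 0.

Lemma f_monomial_cons i u m ms :
  f_monomial (i :: u) (m :: ms) = iter m (obind (f_op i)) (f_monomial u ms).
Proof. by []. Qed.

Lemma demazure_cons i u x : demazure (i :: u) x <->
  exists m y, demazure u y /\ iter m (obind (f_op i)) (Some y) = Some x.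
Proof.
split=> [[[|m ms] // [sz]]|[m [y [[ms sz mon] it]]]]; last first.
  by exists (m :: ms); rewrite ?f_monomial_cons ?mon //= sz.
rewrite f_monomial_cons; case E: (f_monomial u ms) => [y|] it.
  by exists m, y; split=> //; exists ms.
by rewrite (_ : iter _ _ _ = None) ?iter_fix in it.
Qed.

Theorem demazure_grassmannian u : grassmannian u ->
  demazure u = bounded_pairs (pbound u) (nbound u).
Proof.
elim: u => [|i u IH] giu.
  apply/seteqP; split=> [x [m _]|[S T] [/= tS tT eST bS bT]].
    have -> : f_monomial [::] m = Some ([::], [::]) by case: m.
    move=> [<-].
    by split; try split; move=> // r k; rewrite /len nth_nil.
  exists [::] => //; rewrite (_ : f_monomial _ _ = Some ([::], [::])) //; congr Some.
  have nilE (t : tableau) e : istab t -> (forall r, e r = 0) -> bounded e t -> [::] = t.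
    move=> tt e0 bt; apply/esym/size0nil/eqP; rewrite -leqn0 leqNgt tab_size //.
    apply/negP => len_t; have := bt 0 0 len_t.
    by rewrite e0 leqn0 gtn_eqF // tab_pos.
  by rewrite -(nilE S _ tS _ bS) // -(nilE T _ tT _ bT).
have gu := grassmannian_tail giu.
have [p [q [np pq step_n step_p _]]] := grassmannian_cons giu.
have nlr r : npart u r != val (zright i) by rewrite -pq npart_neq_ppart.
have plr r : ppart u r != val (zleft i) by rewrite -np eq_sym npart_neq_ppart.
apply/seteqP.
suff H x : bounded_pairs (pbound (i :: u)) (nbound (i :: u)) x <->
    exists m y, bounded_pairs (pbound u) (nbound u) y /\
                iter m (obind (f_op i)) (Some y) = Some x.
  by split=> x; rewrite demazure_cons IH // H.
case: i giu np pq step_n step_p nlr plr => [[|n]|n] giu np pq step_n step_p nlr plr.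
- have [nd pd] := part_sign gu.
  have [ep eq] := grassmannian_zero_step gu nd pd np pq; set d := count_mem _ _ in nd pd ep eq.
  have -> : pbound (Posz 0 :: u) = bump_at (pbound u) d 1.
    apply/funext => r; rewrite /pbound step_p /bump_at eq.
    by case: eqP.
  have -> : nbound (Posz 0 :: u) = bump_at (nbound u) d 1.
    apply/funext => r; rewrite /nbound step_n /bump_at ep.
    by case: eqP.
  apply: bounded_pairs_f_zero.
  + by have := pd d; rewrite ltnn /pbound; case: ppart.
  + by have := nd d; rewrite ltnn /nbound; case: npart => // -[].
  + by move=> r lt_r; have := pd r; rewrite ltnNge ltnW // /pbound; case: ppart.
  + by move=> r lt_r; have := pd r; rewrite lt_r /pbound; case: ppart.
  + by move=> r lt_r; have := nd r; rewrite lt_r /nbound; case: npart.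
(* The value at [q] drops from [n + 2] to [n + 1]; both are positive, so [pbound] is 0 there in
   either case. *)
- have -> : pbound (Posz n.+1 :: u) = pbound u.
    apply/funext => r; rewrite /pbound step_p; case: eqP => // ->.
    by rewrite pq.
  have -> : nbound (Posz n.+1 :: u) = bump_at (nbound u) p n.+2.
    by apply/funext => r; rewrite /nbound step_n /bump_at; case: eqP.
  apply: bounded_pairs_f_op_pos.
  + by rewrite /nbound np.
  (* The value [n + 2] is taken by [ppart u q], so what exceeds [n + 1] is at least [n + 3]. *)
  + move=> r /(npart_lt gu); have := nlr r; rewrite np /nbound /=.
    by case: npart => m; rewrite ?NegzE; lia.
  + move=> r /(npart_lt gu); rewrite np /nbound /=.
    by case: npart => m; rewrite ?NegzE; lia.
- have -> : nbound (Negz n :: u) = nbound u.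
    apply/funext => r; rewrite /nbound step_n; case: eqP => // ->.
    by rewrite np.
  have -> : pbound (Negz n :: u) = bump_at (pbound u) q n.+2.
    by apply/funext => r; rewrite /pbound step_p /bump_at; case: eqP.
  apply: bounded_pairs_f_op_neg.
  + by rewrite /pbound pq.
  + move=> r /(ppart_lt gu); have := plr r; rewrite pq /pbound /=.
    by case: ppart => m; rewrite ?NegzE; lia.
  + move=> r /(ppart_lt gu); rewrite pq /pbound /=.
    by case: ppart => m; rewrite ?NegzE; lia.
Qed.

(** * The partition lambda(w) *)

(** Finiteness is carried along because [fset_set] is meaningful only on finite sets. *)
Definition has_card (T : choiceType) (A : set T) (n : nat) : Prop :=
  finite_set A /\ #|` fset_set A| = n.

Lemma has_card0 (T : choiceType) : has_card (@set0 T) 0.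
Proof. by split; rewrite ?fset_set0 ?cardfs0. Qed.

Lemma has_cardU1 (T : choiceType) (A : set T) n x :
  has_card A n -> ~ A x -> has_card (x |` A) n.+1.
Proof.
move=> [finA <-] nAx; split; first by rewrite finite_setU; split.
by rewrite fset_setU1 // cardfsU1 in_fset_set // memNset.
Qed.

Lemma has_card_image (T U : choiceType) (f : T -> U) (A : set T) n :
  injective f -> has_card A n -> has_card (f @` A) n.
Proof.
move=> inj [finA <-]; split; first exact: finite_image.
by rewrite fset_set_image // card_imfset.
Qed.

Lemma has_card_interval n : has_card [set r | r < n] n.
Proof.
elim: n => [|n IH].
  have -> : [set r | r < 0] = set0 by apply/seteqP; split.
  exact: has_card0.
have -> : [set r | r < n.+1] = n |` [set r | r < n].
  have ltS r : (r < n.+1) = (r == n) || (r < n) by rewrite ltnS leq_eqVlt.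
  apply/seteqP; split=> r /=; rewrite ltS.
    by case/predU1P; [left | right].
  by case=> ->; rewrite ?eqxx ?orbT.
by apply: has_cardU1 => //=; rewrite ltnn.
Qed.

(* The number of boxes of lambda(w) in the row (resp. column) indexed by [r],
   read off the value of w at -(r + 1) (resp. r + 1). *)
Definition row_size u r : int := (npart u r - Posz (0 < npart u r)%R + Posz r.+1)%R.
Definition col_size u r : int := (Posz r.+1 - ppart u r - Posz (ppart u r < 0)%R)%R.

(** The set counted by [lambda_part], pulled back along the action of [u]; it then changes by one
    element at each letter. *)
Definition above_neg u r : set Zx :=
  [set m | (val (zneg r) < val m)%R /\ (val (word_act u m) < npart u r)%R].

Definition above_pos u r : set nat := [set k | (ppart u r < npart u k)%R].

(** Only row [p] changes, gaining [zpos q]. Its value grows by 1, or for [i = 0] by 2 from -1 to 1,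
    and the indicator in [row_size] absorbs the excess. *)
Lemma has_card_above_neg u r : grassmannian u ->
  exists2 n, has_card (above_neg u r) n & row_size u r = Posz n.
Proof.
elim: u r => [|i u IH] r giu.
  exists 0; last by rewrite /row_size /npart /= NegzE; lia.
  rewrite (_ : above_neg _ _ = set0); first exact: has_card0.
  by apply/seteqP; split=> // m [/lt_trans H /H]; rewrite ltxx.
have gu := grassmannian_tail giu; have [n cn rn] := IH r gu.
have [p [q [np pq step_n step_p step]]] := grassmannian_cons giu.
case: (eqVneq r p) => [er|nr]; last first.
  exists n; last by rewrite -rn /row_size step_n (negPf nr).
  rewrite (_ : above_neg _ _ = above_neg u r) //.
  have nm m : (m, r) <> (zpos q, p) by move=> [_ er]; rewrite er eqxx in nr.
  by apply/seteqP; split=> m [lt_m lt_u]; split=> //; [rewrite -step | rewrite step].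
exists n.+1; last first.
  move: rn; rewrite /row_size step_n er eqxx np.
  by case: (i) => [[|k]|k] /=; rewrite ?NegzE; lia.
rewrite (_ : above_neg _ _ = zpos q |` above_neg u r).
  apply: has_cardU1 => // -[_]; apply/negP; rewrite -leNgt.
  by rewrite -/(ppart u q) pq er np ltW ?zleft_lt_right.
apply/seteqP; split=> m.
  case: (eqVneq m (zpos q)) => [|nm [lt_m lt_u]]; [by left | right].
  by split=> //; rewrite step // in lt_u => -[em]; rewrite em eqxx in nm.
case: (eqVneq m (zpos q)) => [-> _|nm [em|[lt_m lt_u]]].
- split=> //; rewrite -/(ppart _ q) step_p step_n er !eqxx.
  exact: zleft_lt_right.
- by rewrite em eqxx in nm.
- by split=> //; rewrite step // => -[em]; rewrite em eqxx in nm.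
Qed.

Lemma has_card_above_pos u r : grassmannian u ->
  exists2 n, has_card (above_pos u r) n & col_size u r = Posz n.
Proof.
elim: u r => [|i u IH] r giu.
  exists 0; last by rewrite /col_size /ppart /=; lia.
  rewrite (_ : above_pos _ _ = set0); first exact: has_card0.
  by apply/seteqP; split=> // m.
have gu := grassmannian_tail giu; have [n cn rn] := IH r gu.
have [p [q [np pq step_n step_p step]]] := grassmannian_cons giu.
case: (eqVneq r q) => [er|nr]; last first.
  exists n; last by rewrite -rn /col_size step_p (negPf nr).
  rewrite (_ : above_pos _ _ = above_pos u r) //.
  have nm k : (zpos r, k) <> (zpos q, p).
    by case=> er _; rewrite er eqxx in nr.
  by apply/seteqP; split=> k; rewrite /above_pos /mkset /ppart step.
exists n.+1; last first.
  move: rn; rewrite /col_size step_p er eqxx pq.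
  by case: (i) => [[|k]|k] /=; rewrite ?NegzE; lia.
rewrite (_ : above_pos _ _ = p |` above_pos u r).
  apply: has_cardU1 => //; apply/negP; rewrite -leNgt.
  by rewrite er pq np ltW ?zleft_lt_right.
have nk k : k != p -> (zpos r, k) <> (zpos q, p) by move=> + [_ ek]; rewrite ek eqxx.
apply/seteqP; split=> k.
  case: (eqVneq k p) => [|nkp]; first by left.
  by rewrite /above_pos /mkset /ppart step; [right | exact: nk].
case: (eqVneq k p) => [-> _|nkp [ek|]].
- by rewrite /above_pos /mkset step_p step_n er !eqxx zleft_lt_right.
- by rewrite ek eqxx in nkp.
- by rewrite /above_pos /mkset /ppart step //; apply: nk.
Qed.

(* Both sides say that lambda(w) has a box in row [k] and column [r]. *)
Lemma row_size_gt u r k : grassmannian u ->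
  (Posz r < row_size u k)%R = (ppart u r < npart u k)%R.
Proof.
elim: u r k => [|i u IH] r k giu.
  by rewrite /row_size /npart /ppart /= NegzE; lia.
have gu := grassmannian_tail giu.
have [p [q [np pq step_n step_p step]]] := grassmannian_cons giu.
have sz_p : row_size (i :: u) p = (row_size u p + 1)%R.
  rewrite /row_size step_n eqxx np.
  by case: (i) => [[|m]|m] /=; rewrite ?NegzE; lia.
(* The new box must extend row [p]. By induction that row has no box in column [q]; it has one in
   column [q - 1], because the value there lies below [zright i], hence below [zleft i]. *)
have sz_q : row_size u p = Posz q.
  have [n _ en] := has_card_above_neg p gu; rewrite en.
  have lr := zleft_lt_right i.
  have le_nq : (Posz n <= Posz q)%R by have := IH q p gu; rewrite np pq en; lia.
  have [lt_nq|] := ltnP n q; last by move: le_nq; lia.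
  have := IH q.-1 p gu; have := @ppart_lt u q.-1 q gu; rewrite en np pq.
  have := zleft_right_gap i (word_act u (zpos q.-1)).
  have := npart_neq_ppart u p q.-1; rewrite np /ppart; lia.
have [er|nr] := eqVneq k p; last first.
  rewrite [in RHS]/ppart step; last by case=> _ ek; rewrite ek eqxx in nr.
  by rewrite /row_size step_n (negPf nr) -/(row_size u k) IH.
have [eq|nq] := eqVneq r q.
  rewrite er eq sz_p sz_q step_n step_p !eqxx zleft_lt_right; lia.
rewrite /ppart step; last by case=> /eqP; rewrite (negPf nq).
rewrite -/(ppart u r) -IH // er sz_p sz_q; lia.
Qed.

(** * From the Weyl group to words *)

Section Transfer.
Variable R : realType.

Lemma reflectionE i (lam : hdual R) k : reflection i lam k = lam (ztransp i k).
Proof.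
rewrite -[LHS]/(lam k - (lam (zleft i) - lam (zright i)) *
                 ((zleft i == k)%:R - (zright i == k)%:R))%R.
have neq := zleft_neq_right i; rewrite [zleft i == k]eq_sym [zright i == k]eq_sym.
rewrite /ztransp; case: (eqVneq k (zleft i)) => [->|nl].
  by rewrite (negPf neq) mulr1n mulr0n subr0 mulr1 subKr.
case: (eqVneq k (zright i)) => [->|nr]; last by rewrite mulr0n subrr mulr0 subr0.
by rewrite mulr1n mulr0n sub0r mulrN1 opprK addrC subrK.
Qed.

Lemma word_mapE u (lam : hdual R) k : word_map u lam k = lam (word_act (rev u) k).
Proof. by elim: u k => //= i u IH k; rewrite reflectionE IH rev_cons word_act_rcons. Qed.

(** A form is transformed by precomposition with the inverse permutation, so words with the same
    action give the same element of W. *)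
Lemma eq_word_map u v : word_act u =1 word_act v -> word_map (R := R) u = word_map v.
Proof.
move=> uv; apply/funext => lam; apply/funext => k; rewrite !word_mapE; congr lam.
by apply: (@word_act_inj u); rewrite word_actVK uv word_actVK.
Qed.

Lemma weyl_length_le (w : weyl R) v : weyl_map w = word_map v ->
  weyl_length w <= size v.
Proof.
move=> wv; rewrite /weyl_length; case: ex_minnP => n _; apply.
by apply/asboolP; exists v.
Qed.

Lemma reduced_grassmannian (w : weyl R) u : in_WLambda0 w ->
  reduced_expression w u -> grassmannian u.
Proof.
move=> hw [wu sz]; split=> [v vu|j v j0 vu].
  by rewrite sz; apply: weyl_length_le; rewrite wu; apply/esym/eq_word_map.
rewrite sz; apply: leq_trans (hw j j0) _; apply: weyl_length_le.
rewrite /= wu (@eq_word_map v (rcons u j)).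
  by elim: (u) => //= i u' <-.
by move=> z; rewrite vu word_act_rcons.
Qed.

Variables (w : weyl R) (u : seq int).
Hypotheses (gu : grassmannian u) (wu : weyl_map w = word_map u).
Let d := count_mem 0%R u.

Lemma weyl_actVK : cancel (weyl_actV w) (weyl_act w).
Proof. exact: word_actVK. Qed.

Lemma lambda_partE r : Posz (lambda_part w r.+1) = row_size u r.
Proof.
have [n cn ->] := has_card_above_neg r gu; congr Posz.
rewrite /lambda_part -pred_Sn (weyl_actE wu); set A := [set _ | _].
have -> : A = word_act u @` above_neg u r.
  apply/seteqP; split=> j; rewrite /A /mkset.
    move=> [lt1 lt2]; exists (weyl_actV w j).
      by split; rewrite // -(weyl_actE wu) weyl_actVK.
    by rewrite -(weyl_actE wu) weyl_actVK.
  by move=> [m [lt1 lt2] <-]; rewrite -{1}(weyl_actE wu) weyl_actK.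
by have [_] := has_card_image (@word_act_inj u) cn.
Qed.

Lemma conj_partE r : Posz (conj_part (lambda_part w) r.+1) = col_size u r.
Proof.
have [n cn ->] := has_card_above_pos r gu; congr Posz.
rewrite /conj_part; set A := [set _ | _].
have -> : A = succn @` above_pos u r.
  apply/seteqP; split=> [[[]//|k] [_ le_r]|_ [k lt_k <-]].
    by exists k => //; rewrite /above_pos /mkset -row_size_gt // -lambda_partE ltz_nat.
  split=> //; rewrite -ltz_nat lambda_partE row_size_gt //.
by have [_] := has_card_image succn_inj cn.
Qed.

Lemma weyl_diagE : weyl_diag w = d.
Proof.
have [nd _] := part_sign gu.
rewrite /weyl_diag /diag_length; set A := [set _ | _].
(* A diagonal box in row [r] means [npart u r] minus its indicator is nonnegative; as the value is
   not 0, it is positive. *)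
have mem_A r : (r.+1 <= lambda_part w r.+1) = (r < d).
  rewrite /d -nd -ltz_nat lambda_partE /row_size.
  by have := npart_neq0 u r; lia.
have -> : A = succn @` [set r | r < d].
  apply/seteqP; split=> [[[]//|k] [_]|_ [k lt_k <-]].
    by rewrite mem_A => lt_k; exists k.
  by split; rewrite // mem_A.
by have [_] := has_card_image succn_inj (has_card_interval d).
Qed.

Lemma frob_alphaE r : r < d -> frob_alpha w r.+1 = pbound u r.
Proof.
move=> lt_r; rewrite /frob_alpha; have := conj_partE r; rewrite /col_size /pbound.
have [_ pd] := part_sign gu; have := pd r; rewrite lt_r.
by case: (ppart u r) => m //= _; rewrite NegzE /=; lia.
Qed.

Lemma frob_betaE r : r < d -> frob_beta w r.+1 = nbound u r.
Proof.
move=> lt_r; rewrite /frob_beta; have := lambda_partE r; rewrite /row_size /nbound.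
have [nd _] := part_sign gu; have := nd r; rewrite lt_r.
by case: (npart u r) => -[|m] //= _; lia.
Qed.

(** The flag is silent on rows from [d] on, which are empty by [size nu <= d]. The reversal of the
    list undoes the index [size phi - r.+1]. *)
Lemma SST_flagE (frob : nat -> nat) (b : nat -> nat) nu t :
  0 \notin nu -> size nu <= d -> (forall r, r < d -> frob r.+1 = b r) ->
  SST_flag (rev [seq frob i | i <- iota 1 d]) nu t <->
  [/\ map size t = nu, istab t & bounded b t].
Proof.
move=> nz le_nu fb; set phi := rev _.
have sz : size phi = d by rewrite size_rev size_map size_iota.
have nth_phi r : r < d -> nth 0 phi (size phi - r.+1) = b r.
  move=> lt_r; rewrite nth_rev size_map size_iota ?sz ?(subnSK, ltn_subLR); try lia.
  rewrite (nth_map 0) ?size_iota ?nth_iota; try lia.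
  by rewrite -fb //; congr frob; lia.
split=> [[/(SST_istab _ nz) [sh tt] bt]|[sh tt bt]].
  split=> // r k lt_k.
  have lt_r : r < d.
    by apply: leq_trans le_nu; rewrite -sh size_map; apply: len_gt_size lt_k.
  have := bt r; rewrite sz => /(_ lt_r) /(all_nthP 0)/(_ k lt_k).
  by rewrite -sz nth_phi.
split; first by apply/SST_istab.
move=> r; rewrite {1}sz => lt_r; apply/(all_nthP 0) => k lt_k.
by rewrite nth_phi //; apply: bt.
Qed.

End Transfer.

Theorem theorem5p7 (R : realType) (w : weyl R) (hw : in_WLambda0 w)
    (u : seq int) (hu : reduced_expression w u) :
  let shapes := [set nu : seq nat |
    is_partition nu /\ (size nu <= weyl_diag w)%N] in
  let summand := fun nu : seq nat =>
    SST_flag (flag_phi w) nu `*` SST_flag (flag_psi w) nu in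
  trivIset shapes summand /\ demazure u = \bigcup_(nu in shapes) summand nu.
Proof.
move=> shapes summand; split.
  move=> nu mu _ _ [[S T] [[[[<- _ _ _] _] _] [[[-> _ _ _] _] _]]] //.
have gu := reduced_grassmannian hw hu; have [wu _] := hu.
have dE := weyl_diagE gu wu.
have flag nu S T : is_partition nu -> size nu <= weyl_diag w ->
    summand nu (S, T) <-> [/\ map size S = nu, map size T = nu, istab S, istab T &
                           bounded (pbound u) S /\ bounded (nbound u) T].
  move=> /andP[_ nz] le_nu; rewrite /summand /flag_phi /flag_psi.
  rewrite dE in le_nu *.
  have HS := SST_flagE S nz le_nu (frob_alphaE gu wu).
  have HT := SST_flagE T nz le_nu (frob_betaE gu wu).
  split=> [[/= /HS [? ? ?] /HT [? ? ?]]|[? ? ? ? [? ?]]]; first by split.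
  by split; [apply/HS | apply/HT].
rewrite (demazure_grassmannian gu); apply/seteqP; split=> -[S T].
  move=> [/= tS tT eST bS bT].
  (* An entry in row [d] of [S] would be positive and at most [pbound u d = 0]. *)
  have le_S : size (map size S) <= weyl_diag w.
    rewrite size_map leqNgt tab_size // dE; apply/negP => len_S.
    have := bS _ _ len_S; have [_ pd] := part_sign gu.
    have := tab_pos tS len_S; have := pd (count_mem 0%R u).
    by rewrite ltnn /pbound; case: ppart => // m _; case: (ent _ _ _).
  exists (map size S); first by split=> //; apply: tab_partition.
  apply/flag => //; first exact: tab_partition.
  by split=> //; apply: tab_shape => // r; rewrite eST.
move=> [nu [part le_nu] /(flag _ _ _ part le_nu) [eS eT tS tT [bS bT]]].
by split=> //=; apply: shape_len; rewrite eS eT.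
Qed.
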